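(* Let $\mathcal H$ be a real Hilbert space, let $m\geq 1$ be an integer, let $z\in\mathcal H$, and let $(\omega_i)_{1\leq i\leq m}$ be reals in $]0,1]$ such that $\sum_{i=1}^m\omega_i=1$. For every $i\in\{1,\ldots,m\}$, let $\mathcal G_i$ be a real Hilbert space, let $r_i\in\mathcal G_i$, let $B_i\colon\mathcal G_i\to 2^{\mathcal G_i}$ be maximally monotone, and let $L_i\colon\mathcal H\to\mathcal G_i$ be a nonzero bounded linear operator. Assume that $$z\in\operatorname{ran}\sum_{i=1}^m\omega_iL_i^*\circ B_i\circ(L_i\cdot-r_i).$$ Consider the problem $$\text{find } x\in\mathcal H\text{ such that } z\in\sum_{i=1}^m\omega_iL_i^*B_i(L_ix-r_i),\qquad\text{(P)}$$ and the problem $$\text{find } v_1\in\mathcal G_1,\ldots,v_m\in\mathcal G_m\text{ such that }\sum_{i=1}^m\omega_iL_i^*v_i=z\text{ and }(\exists\, x\in\mathcal H)\ (\forall i\in\{1,\ldots,m\})\ v_i\in B_i(L_ix-r_i).\qquad\text{(D)}$$ For every $i\in\{1,\ldots,m\}$, let $(a_{1,i,n})_{n\in\mathbb N}$ and $(c_{1,i,n})_{n\in\mathbb N}$ be absolutely summable sequences in $\mathcal H$, let $(a_{2,i,n})_{n\in\mathbb N}$, $(b_{i,n})_{n\in\mathbb N}$, and $(c_{2,i,n})_{n\in\mathbb N}$ be absolutely summable sequences in $\mathcal G_i$, let $x_{i,0}\in\mathcal H$, and let $v_{i,0}\in\mathcal G_i$. Furthermore, set $\beta=\max_{1\leq i\leq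 m}\|L_i\|$, let $\varepsilon\in\,]0,1/(\beta+1)[$, let $(\gamma_n)_{n\in\mathbb N}$ be a sequence in $[\varepsilon,(1-\varepsilon)/\beta]$, and set, for every $n\in\mathbb N$, $x_n=\sum_{i=1}^m\omega_ix_{i,n}$; then, for $i=1,\ldots,m$, $$\begin{array}{l} y_{1,i,n}=x_{i,n}-\gamma_n(L_i^*v_{i,n}+a_{1,i,n})\\ y_{2,i,n}=v_{i,n}+\gamma_n(L_ix_{i,n}+a_{2,i,n}); \end{array}$$ then $p_{1,n}=\sum_{i=1}^m\omega_iy_{1,i,n}+\gamma_nz$; then, for $i=1,\ldots,m$, $$\begin{array}{l} p_{2,i,n}=J_{\gamma_nB_i^{-1}}(y_{2,i,n}-\gamma_nr_i)+b_{i,n}\\ q_{1,i,n}=p_{1,n}-\gamma_n(L_i^*p_{2,i,n}+c_{1,i,n})\\ q_{2,i,n}=p_{2,i,n}+\gamma_n(L_ip_{1,n}+c_{2,i,n})\\ x_{i,n+1}=x_{i,n}-y_{1,i,n}+q_{1,i,n}\\ v_{i,n+1}=v_{i,n}-y_{2,i,n}+q_{2,i,n}. \end{array}$$ Then the following hold for some solution $\overline{x}$ to (P) and some solution $(\overline{v}_i)_{1\leq i\leq m}$ to (D) such that, for every $i\in\{1,\ldots,m\}$, $\overline{v}_i\in B_i(L_i\overline{x}-r_i)$. (i) $x_n\rightharpoonup\overline{x}$ and, for every $i\in\{1,\ldots,m\}$, $v_{i,n}\rightharpoonup\overline{v}_i$. (ii) Suppose that, for every $i\in\{1,\ldots,m\}$,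 $B_i^{-1}$ is strongly monotone at $\overline{v}_i$. Then, for every $i\in\{1,\ldots,m\}$, $v_{i,n}\to\overline{v}_i$.
   Context: $\rightharpoonup$ and $\to$ denote weak and strong convergence; a sequence $(a_n)$ is absolutely summable if $\sum_n\|a_n\|<+\infty$. $L_i^*$ is the adjoint of $L_i$. For a set-valued operator $M\colon\mathcal H\to 2^{\mathcal H}$: $\operatorname{dom}M=\{x\mid Mx\neq\varnothing\}$, $\operatorname{ran}M=\{u\mid(\exists x)\ u\in Mx\}$, $\operatorname{gra}M=\{(x,u)\mid u\in Mx\}$, $M^{-1}$ is the operator with graph $\{(u,x)\mid u\in Mx\}$, and the resolvent is $J_M=(\operatorname{Id}+M)^{-1}$ (single-valued with full domain when $M$ is maximally monotone). $M$ is monotone if $\langle x-y\mid u-v\rangle\geq 0$ for all $(x,u),(y,v)\in\operatorname{gra}M$, and maximally monotone if no monotone operator has a graph properly containing $\operatorname{gra}M$. The operator $\sum_{i=1}^m\omega_iL_i^*\circ B_i\circ(L_i\cdot-r_i)$ is $x\mapsto\sum_{i=1}^m\omega_iL_i^*(B_i(L_ix-r_i))$ (Minkowski sum of sets). $M$ is strongly monotone at $x\in\operatorname{dom}M$ if there exists $\rho\in\,]0,+\infty[$ such that, for every $u\in Mx$ and every $(y,v)\in\operatorname{gra}M$, $\langle x-y\mid u-v\rangle\geq\rho\|x-y\|^2$. *)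

(* Defs.v *)
From HB Require Import structures.
From mathcomp Require Import all_boot all_order all_algebra.
From mathcomp Require Import all_classical all_reals all_analysis.

Set Implicit Arguments.
Unset Strict Implicit.
Unset Printing Implicit Defensive.

Import Order.TTheory GRing.Theory Num.Theory.
Import numFieldNormedType.Exports.

Local Open Scope classical_set_scope.
Local Open Scope ring_scope.

HB.mixin Record hasInnerProduct (R : realType) H of CompleteNormedModule R H := {
  inner : {dot H for (@idfun R)} ;
  inner_norm : forall x : H, `|x| ^+ 2 = inner x x
}.

#[short(type="hilbertType")]
HB.structure Definition Hilbert (R : realType) :=
  {H of CompleteNormedModule R H & hasInnerProduct R H}.

(* Set-valued operators A -> 2^B are functions A -> set B. *)

Section SetValuedOperators.
Context {A B : Type}.
Implicit Types M : A -> set B.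

Definition gra M : set (A * B) := [set p | M p.1 p.2].
Definition dom M : set A := [set x | M x !=set0].
Definition ran M : set B := [set u | exists x, M x u].
Definition opinv M : B -> set A := fun u => [set x | M x u].

End SetValuedOperators.

Section HilbertNotions.
Context {R : realType}.
Implicit Types H G : hilbertType R.

Definition monotone H (M : H -> set H) : Prop :=
  forall p q : H * H, gra M p -> gra M q -> 0 <= inner (p.1 - q.1) (p.2 - q.2).

Definition maximally_monotone H (M : H -> set H) : Prop :=
  monotone M /\ forall N : H -> set H, monotone N -> ~ (gra M `<` gra N).

Definition strongly_monotone_at H (M : H -> set H) (x : H) : Prop :=
  dom M x /\ exists2 rho : R, 0 < rho &
    forall u, M x u -> forall q : H * H, gra M q ->
      rho * `|x - q.1| ^+ 2 <= inner (x - q.1) (u - q.2).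

Definition op_scale H (g : R) (M : H -> set H) : H -> set H :=
  fun x => [set g *: u | u in M x].

Definition id_plus H (M : H -> set H) : H -> set H :=
  fun x => [set x + u | u in M x].

(* J_M is the set-valued (Id + M)^-1; by Minty's theorem its values are
   singletons when M is maximally monotone, and J M x is then the unique
   element. Otherwise J M x is an arbitrary element of the value, or a
   default point if the value is empty. *)
Definition resolvent H (M : H -> set H) : H -> set H := opinv (id_plus M).
Definition J H (M : H -> set H) (x : H) : H := get (resolvent M x).

(* By the Riesz theorem, exactly one w satisfies the condition when L is
   linear and bounded. *)
Definition adjoint H G (L : H -> G) (v : G) : H :=
  get [set w | forall x : H, inner (L x) v = inner x w].

Definition opnorm H G (L : H -> G) : R :=
  sup [set `|L x| | x in [set x : H | `|x| <= 1]].

Definition absolutely_summable H (a : nat -> H) : Prop :=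
  cvgn [normed series a].

Definition weak_cvg H (u : nat -> H) (l : H) : Prop :=
  forall y : H, (fun n => inner (u n) y) @ \oo --> inner l y.

Definition minkowski_sum H (m : nat) (S : 'I_m -> set H) : set H :=
  [set \sum_(i < m) f i | f in [set f : 'I_m -> H | forall i, S i (f i)]].

(* The operator x |-> \sum_i w_i L_i^* (B_i (L_i x - r_i)). *)
Definition composite_op H m (G : 'I_m -> hilbertType R) (w : 'I_m -> R)
    (L : forall i, {linear H -> G i}) (r : forall i, G i)
    (B : forall i, G i -> set (G i)) : H -> set H := fun x =>
  minkowski_sum (fun i =>
    [set w i *: adjoint (L i) v | v in B i (L i x - r i)]).

Definition primal_solution H m (G : 'I_m -> hilbertType R) (w : 'I_m -> R)
    (L : forall i, {linear H -> G i}) (r : forall i, G i)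
    (B : forall i, G i -> set (G i)) (z : H) (x : H) : Prop :=
  composite_op w L r B x z.

Definition dual_solution H m (G : 'I_m -> hilbertType R) (w : 'I_m -> R)
    (L : forall i, {linear H -> G i}) (r : forall i, G i)
    (B : forall i, G i -> set (G i)) (z : H) (v : forall i, G i) : Prop :=
  \sum_(i < m) w i *: adjoint (L i) (v i) = z /\
  exists x : H, forall i, B i (L i x - r i) (v i).

End HilbertNotions.

(* Main.v *)
Require Import Defs.
From HB Require Import structures.
From mathcomp Require Import all_boot all_order all_algebra.
From mathcomp Require Import all_classical all_reals all_analysis.
From mathcomp Require Import ring lra.

Set Implicit Arguments.
Unset Strict Implicit.
Unset Printing Implicit Defensive.

Import Order.TTheory GRing.Theory Num.Theory.
Import numFieldNormedType.Exports.

Local Open Scope classical_set_scope.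
Local Open Scope ring_scope.

(** The recursion is the forward-backward-forward splitting method for
    finding a zero of a sum [A + S] of a monotone operator and a monotone
    Lipschitz map, run in the Hilbert sum of [m] copies of the primal space
    and of the dual spaces [G i], with coordinates of index [i] weighted by
    [w i].  There

      [A (x, v) = (N (x) - z) x prod_i (r_i + B_i^-1 v_i)],
      [S (x, v) = ((L_i^* v_i)_i, (- L_i x_i)_i)],

    where [N] is the normal cone of the diagonal subspace.  The map [S] is
    linear and skew, hence monotone, and Lipschitz with constant [beta]; the
    zeros of [A + S] are exactly the pairs formed by a primal solution,
    repeated on the diagonal, and a dual solution attached to it
    ([pd_zeroP]).  The resolvent of [A] averages the primal coordinates, shifts
    the average along [z], and applies the resolvents of [B_i^-1] to the shifted
    dual coordinates.

    Convergence of the abstract method ([forward_backward_forward_cvg]) rests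
    on one inequality ([fbf_descent]): with [p] the exact resolvent point and
    [x+] the exact update, for each zero [z],

      [|x+ - z|^2 + eps |x - p|^2 + 2 g <p - z, u + S z> <=
         |x - z|^2 + summable error],    with [u] in [A p].

    Hence the distances to [z] converge, and both extra terms on the left
    vanish in the limit.  So [A + S] takes values tending to [0] at points
    that stay asymptotically close to the iterates, and every weak cluster
    point is a zero because the graph of a maximally monotone operator is
    weak-strong closed.  Opial's argument then leaves a single cluster point.
    Strong convergence of the dual variables comes from the vanishing of
    [<p - z, u + S z>] at the limit [z]: when the [B_i^-1] are strongly monotone
    there, this quantity dominates a multiple of the squared distance from the
    dual part of [p] to that of [z].

    Three pieces of functional analysis are built on the way.  Minimizing
    [t + |x|^2 / 2] over the epigraph of a supremum of convex functions
    ([proximal_point]) needs only completeness and the parallelogram law, and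
    yields both the Riesz theorem and, through the Fitzpatrick function,
    Minty's theorem on the existence of resolvents.  Weak compactness of
    bounded sequences takes the form of weak limits along ultrafilters, which
    avoids extracting subsequences. *)

(** * Inner products *)

(** Modules without a norm are allowed because the triangle inequality for the
    norm of a Hilbert sum is derived from this inequality. *)
Lemma dot_cauchy_schwarz (R : realType) (V : lmodType R)
    (dot : {dot V for (@idfun R)}) (x y : V) :
  dot x y ^+ 2 <= dot x x * dot y y.
Proof.
have dotC u v : dot u v = dot v u by rewrite hermC /= mul1r.
have dot_gt0 u : u != 0 -> 0 < dot u u by exact: neq0_dnorm_gt0.
have [->|y0] := eqVneq y 0; first by
  rewrite (linear0r dot x) (linear0r dot 0) mulr0 expr0n.
have yy0 := dot_gt0 _ y0.
have : 0 <= dot (dot y y *: x - dot x y *: y) (dot y y *: x - dot x y *: y).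
  have [->|t0] := eqVneq (dot y y *: x - dot x y *: y) 0.
    by rewrite linear0r.
  exact/ltW/dot_gt0.
have dotBZ u a b : dot u (a *: x - b *: y) = a * dot u x - b * dot u y.
  by rewrite linearBr !linearZr_LR.
rewrite dotBZ !(dotC (_ - _)) !dotBZ (dotC y x) => h.
rewrite -subr_ge0 -(pmulr_rge0 _ yy0); apply: le_trans h _.
by rewrite le_eqVlt; apply/orP; left; apply/eqP; ring.
Qed.

Section InnerProduct.
Context {R : realType} {H : hilbertType R}.
Implicit Types (x y z : H) (a : R).

Lemma innerC x y : inner x y = inner y x.
Proof. by rewrite hermC /= mul1r. Qed.

Lemma innerDl x y z : inner (x + y) z = inner x z + inner y z.
Proof. by rewrite linearDl. Qed.

Lemma innerDr x y z : inner x (y + z) = inner x y + inner x z.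
Proof. by rewrite linearDr. Qed.

Lemma innerZl a x y : inner (a *: x) y = a * inner x y.
Proof. by rewrite linearZl_LR. Qed.

Lemma innerZr a x y : inner x (a *: y) = a * inner x y.
Proof. by rewrite linearZr_LR. Qed.

Lemma innerNl x y : inner (- x) y = - inner x y.
Proof. by rewrite linearNl. Qed.

Lemma innerNr x y : inner x (- y) = - inner x y.
Proof. by rewrite linearNr. Qed.

Lemma inner0l x : inner 0 x = 0.
Proof. by rewrite linear0l. Qed.

Lemma inner0r x : inner x 0 = 0.
Proof. by rewrite linear0r. Qed.

Definition innerE :=
  (innerDl, innerDr, innerZl, innerZr, innerNl, innerNr, inner0l, inner0r).

Lemma inner_suml (I : Type) (s : seq I) (P : pred I) (F : I -> H) x :
  inner (\sum_(i <- s | P i) F i) x = \sum_(i <- s | P i) inner (F i) x.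
Proof. by rewrite linear_sumlz. Qed.

Lemma inner_sumr (I : Type) (s : seq I) (P : pred I) (F : I -> H) x :
  inner x (\sum_(i <- s | P i) F i) = \sum_(i <- s | P i) inner x (F i).
Proof. by rewrite linear_sumr. Qed.

Lemma sqr_normD x y : `|x + y| ^+ 2 = `|x| ^+ 2 + 2 * inner x y + `|y| ^+ 2.
Proof. by rewrite !inner_norm !innerE (innerC y x); ring. Qed.

Lemma sqr_normB x y : `|x - y| ^+ 2 = `|x| ^+ 2 - 2 * inner x y + `|y| ^+ 2.
Proof. by rewrite sqr_normD normrN innerNr; ring. Qed.

Lemma inner_self_eq0 x : inner x x = 0 -> x = 0.
Proof.
by rewrite -inner_norm => /eqP; rewrite sqrf_eq0 normr_eq0 => /eqP.
Qed.

(** This reduces identities between vectors to identities between real numbers,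
    which [innerE] and [ring] settle. *)
Lemma inner_inj x y : (forall z, inner x z = inner y z) -> x = y.
Proof.
move=> xy; apply/eqP; rewrite -subr_eq0; apply/eqP/inner_self_eq0.
by rewrite {1}innerDl innerNl xy subrr.
Qed.

Lemma cauchy_schwarz x y : `|inner x y| <= `|x| * `|y|.
Proof.
rewrite -(ler_pXn2r (n := 2)) ?nnegrE ?mulr_ge0//.
by rewrite exprMn !inner_norm real_normK ?num_real//; exact: dot_cauchy_schwarz.
Qed.

End InnerProduct.

(** * Proximal points of suprema of convex functions *)

Section ProximalPoint.
Context {R : realType} {K : hilbertType R}.

Lemma cvgn_of_cauchy (u : nat -> K) :
  (forall e : R, 0 < e ->
     exists N, forall n k, (N <= n)%N -> (N <= k)%N -> `|u n - u k| < e) ->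
  cvgn u.
Proof.
move=> uC; apply/cauchy_cvgP/cauchyP => e e0.
have [N uN] := uC e e0.
by exists (u N); exists N => //= n Nn; rewrite -ball_normE /=; apply: uN.
Qed.

(** The supremum of the [phi i] may be infinite at many points, so the function
    is handled through its epigraph: the pair [(x0, t0)] minimizes
    [t + |x|^2 / 2] there.  A minimizing sequence is Cauchy, because by the
    parallelogram law the midpoint of two almost optimal points would otherwise
    fall below the infimum.  The last inequality is the first-order optimality
    condition, obtained by moving from [(x0, t0)] towards [(x, t)]. *)
Lemma proximal_point (I : Type) (phi : I -> K -> R) (c : R) :
  (forall i x y (l : R), 0 <= l <= 1 ->
     phi i ((1 - l) *: x + l *: y) <= (1 - l) * phi i x + l * phi i y) ->
  (forall i, continuous (phi i)) ->
  (exists x t, forall i, phi i x <= t) ->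
  (forall x t, (forall i, phi i x <= t) -> c <= t + `|x| ^+ 2 / 2) ->
  exists x0 t0, (forall i, phi i x0 <= t0) /\
    forall x t, (forall i, phi i x <= t) -> 0 <= t - t0 + inner x0 (x - x0).
Proof.
move=> phi_convex phi_cont [x1 [t1 xt1]] lb.
pose h : nat -> R := harmonic.
have h_gt0 n : 0 < h n by exact: harmonic_gt0.
pose V : set R := [set s | exists x t, (forall i, phi i x <= t) /\
  s = t + `|x| ^+ 2 / 2].
have hasV : has_inf V.
  split; first by exists (t1 + `|x1| ^+ 2 / 2), x1, t1.
  by exists c => _ [x [t [xt ->]]]; apply: lb.
pose mu := inf V.
have mu_le x t : (forall i, phi i x <= t) -> mu <= t + `|x| ^+ 2 / 2.
  by move=> xt; apply: ge_inf; [case: hasV | exists x, t].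
have ex n : {xt : K * R | (forall i, phi i xt.1 <= xt.2) /\
    xt.2 + `|xt.1| ^+ 2 / 2 < mu + h n}.
  apply: cid; have [] := @inf_adherent _ V (h n) _ hasV.
    exact: h_gt0.
  by move=> _ [x [t [xt ->]]] lt; exists (x, t).
pose u n := (sval (ex n)).1; pose s n := (sval (ex n)).2.
have us n i : phi i (u n) <= s n by have [] := svalP (ex n).
have us_lt n : s n + `|u n| ^+ 2 / 2 < mu + h n.
  by have [] := svalP (ex n).
have mid (x y : K) : `|x - y| ^+ 2 =
    2 * `|x| ^+ 2 + 2 * `|y| ^+ 2 - 4 * `|(1 - 2^-1) *: x + 2^-1 *: y| ^+ 2.
  by rewrite !inner_norm !innerE (innerC y x); field.
have close n k : `|u n - u k| ^+ 2 <= 4 * (h n + h k).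
  have ha : (0 : R) <= (2^-1 : R) <= 1 by lra.
  have : mu <= (s n + s k) / 2 + `|(1 - 2^-1) *: u n + 2^-1 *: u k| ^+ 2 / 2.
    apply: mu_le => i.
    by have := phi_convex i (u n) (u k) _ ha; have := us n i;
      have := us k i; lra.
  rewrite mid; move: (`|_ *: u n + _|) (us_lt n) (us_lt k) => q.
  lra.
have inv_cvg : h @ \oo --> 0 by exact: cvg_harmonic.
have /cvg_ex[x0 ux0] : cvgn u.
  apply: cvgn_of_cauchy => e e0.
  have e8 : 0 < e ^+ 2 / 8 by rewrite divr_gt0 ?exprn_gt0.
  have [N _ hN] := (cvgrPdist_lt _ _).1 inv_cvg _ e8.
  exists N => n k Nn Nk.
  have := hN n Nn; have := hN k Nk; rewrite /= !sub0r !normrN.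
  rewrite !ger0_norm ?(ltW (h_gt0 _))// => h1 h2.
  rewrite -(ltr_pXn2r (n := 2)) ?nnegrE ?(ltW e0)//.
  by apply: le_lt_trans (close n k) _; lra.
have nu : `|u n| ^+ 2 @[n --> \oo] --> `|x0| ^+ 2.
  by apply: cvgM; apply: cvg_norm.
pose t0 := mu - `|x0| ^+ 2 / 2.
have xt0 i : phi i x0 <= t0.
  have h1 : phi i (u n) @[n --> \oo] --> phi i x0.
    by apply: cvg_comp ux0 _; exact: phi_cont.
  have h2 : mu + h n - `|u n| ^+ 2 / 2 @[n --> \oo] --> t0.
    rewrite /t0 -[X in X - _](addr0 mu).
    by apply: cvgB; [apply: cvgD => //; exact: cvg_cst | apply: cvgMl].
  apply: (ler_cvg_to h1 h2); apply: nearW => n.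
  by have := us n i; have := us_lt n; lra.
exists x0, t0; split=> // x t xt.
set d := t - t0 + inner x0 (x - x0).
have step l : 0 < l <= 1 -> 0 <= d + l * (`|x - x0| ^+ 2 / 2).
  case/andP=> l0 l1.
  have : mu <= (1 - l) * t0 + l * t + `|(1 - l) *: x0 + l *: x| ^+ 2 / 2.
    apply: mu_le => i; apply: le_trans (phi_convex i _ _ _ _) _.
      by rewrite (ltW l0).
    by apply: lerD; apply: ler_wpM2l => //; lra.
  have -> : (1 - l) *: x0 + l *: x = x0 + l *: (x - x0).
    by rewrite scalerBr scalerBl scale1r addrA addrAC.
  rewrite [in X in X -> _]sqr_normD innerZr normrZ exprMn.
  rewrite (ger0_norm (ltW l0)) => mu_l.
  rewrite -(ler_pM2l l0) mulr0; move: mu_l; rewrite /d /t0; nra.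
have dl : d + l * (`|x - x0| ^+ 2 / 2) @[l --> 0^'+] --> d.
  rewrite -[X in _ --> X]addr0; apply: cvgD; first exact: cvg_cst.
  rewrite -[X in _ --> X](mul0r (`|x - x0| ^+ 2 / 2)); apply: cvgMr_tmp.
  by apply: cvg_at_right_filter; exact: cvg_id.
apply: (cvgr_to_ge dl); near=> l; apply: step; apply/andP; split.
- by near: l; exact: nbhs_right_gt.
- by near: l; exact: nbhs_right_le.
Unshelve. all: by end_near. Qed.

End ProximalPoint.

(** * Riesz representation and adjoints *)

Section RieszAdjoint.
Context {R : realType}.

Lemma lipschitz_continuous (V W : normedModType R) (f : V -> W) (C : R) :
  (forall x y, `|f x - f y| <= C * `|x - y|) -> continuous f.
Proof.
move=> fC x; apply/cvgrPdist_lt => e e0.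
have C0 : 0 < `|C| + 1 by rewrite ltr_wpDl.
near=> y; apply: le_lt_trans (fC x y) _.
have : `|x - y| < e / (`|C| + 1).
  by near: y; apply: cvgr_dist_lt; rewrite ?divr_gt0.
rewrite ltr_pdivlMr// mulrC; apply: le_lt_trans.
by rewrite ler_wpM2r// (le_trans (ler_norm C))// lerDl.
Unshelve. all: by end_near. Qed.

(** The representing vector is the proximal point of [- f]: for a linear
    function the optimality condition is an inequality between linear forms,
    hence an equality. *)
Lemma riesz (K : hilbertType R) (f : K -> R) (C : R) :
  (forall x y, f (x + y) = f x + f y) ->
  (forall a x, f (a *: x) = a * f x) ->
  (forall x, `|f x| <= C * `|x|) ->
  exists w, forall x, f x = inner x w.
Proof.
move=> fD fZ fC.
have fN x : f (- x) = - f x by rewrite -scaleN1r fZ mulN1r.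
have [||||x0 [t0 [x0t0 vi]]] :=
    @proximal_point R K unit (fun _ x => - f x) (- (C ^+ 2) / 2).
- by move=> _ x y l _; rewrite fD !fZ; lra.
- move=> _; apply: (@lipschitz_continuous K R^o _ C) => x y.
  by rewrite opprK addrC -fN -fD distrC; exact: fC.
- by exists 0, (- f 0).
- move=> x t /(_ tt) xt; have := fC x; rewrite ler_norml => /andP[_ fx].
  have := sqr_ge0 (C - `|x|); nra.
exists x0 => y.
have le0 z : f z <= inner x0 z.
  have := vi (z + x0) (- f (z + x0)) (fun=> lexx _); move: (x0t0 tt).
  by rewrite fD addrK {x0t0 vi}; lra.
apply/eqP; rewrite innerC eq_le le0/=.
by have := le0 (- y); rewrite fN innerNr {x0t0 vi}; lra.
Qed.

Lemma adjointP (H G : hilbertType R) (L : {linear H -> G}) :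
  bounded_near L (nbhs (0 : H)) ->
  forall x v, inner (L x) v = inner x (adjoint L v).
Proof.
move=> /linear_boundedP/pinfty_ex_gt0[C _ LC] x v.
suff ex : exists w, forall x, inner (L x) v = inner x w by exact: (getPex ex).
apply: (@riesz H (fun x => inner (L x) v) (C * `|v|)) => [y z|a y|y].
- by rewrite linearD innerDl.
- by rewrite linearZ innerZl.
- apply: le_trans (cauchy_schwarz _ _) _.
  by rewrite mulrAC ler_wpM2r.
Qed.

End RieszAdjoint.

(** * Weak limits along ultrafilters *)

Section WeakLimits.
Context {R : realType} {T : Type}.

Lemma ultra_bounded_cvg (U : set_system T) (f : T -> R) (C : R) :
  UltraFilter U -> (forall t, `|f t| <= C) -> exists l : R, f @ U --> l.
Proof.
move=> UU fC; have UP : ProperFilter U by exact: ultra_proper.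
have fU : (f @ U) `[- C, C]%classic.
  by apply: (@filterE _ U) => t; rewrite /= in_itv/= -ler_norml.
have [l [_ lU]] := segment_compact (fmap_proper_filter f UP) fU.
exists l => V lV.
have [//|UV] := in_ultra_setVsetC (f @^-1` V) UU.
by have [x [? ?]] := lU (~` V) V UV lV.
Qed.

(** If [F] did not contain the preimage of a neighbourhood of [l], an
    ultrafilter refining [F] would contain its complement. *)
Lemma ultra_cvgP (F : set_system T) (W : topologicalType) (f : T -> W) (l : W) :
  Filter F ->
  (forall U, UltraFilter U -> F `<=` U -> f @ U --> l) -> f @ F --> l.
Proof.
move=> FF fU V lV; apply: contrapT => nFV.
have DF : ProperFilter (within (~` (f @^-1` V)) F).
  apply: Build_ProperFilter_ex.
  move=> A FA; apply: contrapT => nA; apply: nFV.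
  apply: (@filterS _ F _ _ _ _ FA) => t At; apply: contrapT => nVt; apply: nA.
  by exists t; exact: At.
have [U [UU DU]] := ultraFilterLemma DF.
have UP : ProperFilter U by exact: ultra_proper.
have FU : F `<=` U by move=> A FA; apply: DU; apply: filterS FA => t At _.
have UnV : U (~` (f @^-1` V)) by apply: DU; apply: (@filterE _ F).
have UV : U (f @^-1` V) := fU U UU FU V lV.
by have [t []] := @filter_ex _ U UP _ (filterI UV UnV).
Qed.

(** The limits of [inner (u t) y], which exist by compactness of bounded
    intervals, depend linearly on [y], so the Riesz theorem provides [l]. *)
Lemma ultra_weak_limit (K : hilbertType R) (U : set_system T) (u : T -> K)
    (C : R) :
  UltraFilter U -> (forall t, `|u t| <= C) ->
  exists l : K, forall y, inner (u t) y @[t --> U] --> inner l y.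
Proof.
move=> UU uC; have UP : ProperFilter U by exact: ultra_proper.
have bnd y t : `|inner (u t) y| <= C * `|y|.
  by apply: le_trans (cauchy_schwarz _ _) _; rewrite ler_wpM2r.
have ex y := cid (ultra_bounded_cvg UU (bnd y)).
pose f y := sval (ex y).
have fP y : inner (u t) y @[t --> U] --> f y := svalP (ex y).
have [||y|w fw] := @riesz R K f C.
- move=> y z; apply: (norm_cvg_unique (fP _)) => //.
  rewrite (_ : (fun t => inner (u t) (y + z)) =
              (fun t => inner (u t) y) \+ (fun t => inner (u t) z)).
    exact: cvgD.
  by apply/funext => t; rewrite innerDr.
- move=> a y; apply: (norm_cvg_unique (fP _)) => //.
  rewrite (_ : (fun t => inner (u t) (a *: y)) =
              (fun t => a * inner (u t) y)).
    exact: cvgMl_tmp.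
  by apply/funext => t; rewrite innerZr.
- have := cvgr_to_le (cvg_norm (fP y)); apply.
  exact: nearW (bnd y).
by exists w => y; rewrite innerC -fw; exact: fP.
Qed.

End WeakLimits.

(** * Weighted Hilbert sums *)

(** The weights are parameters of the type, so that sums of the same spaces with
    different weights carry different inner products. *)
Definition weighted_sum (R : realType) (I : finType) (w : I -> {posnum R})
  (E : I -> hilbertType R) : Type := forall i, E i.

Section HilbertSum.
Context {R : realType} {I : finType}.
Variables (w : I -> {posnum R}) (E : I -> hilbertType R).
Local Notation wsum := (weighted_sum w E).

HB.instance Definition _ := gen_eqMixin wsum.
HB.instance Definition _ := gen_choiceMixin wsum.

Definition wsum_add (X Y : wsum) : wsum := fun i => X i + Y i.
Definition wsum_opp (X : wsum) : wsum := fun i => - X i.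
Definition wsum_scale (a : R) (X : wsum) : wsum := fun i => a *: X i.

Let wsum_ext (X Y : wsum) : (forall i, X i = Y i) -> X = Y.
Proof. exact: functional_extensionality_dep. Qed.

Let addA : associative wsum_add.
Proof. by move=> X Y Z; apply: wsum_ext => i; rewrite /wsum_add addrA. Qed.
Let addC : commutative wsum_add.
Proof. by move=> X Y; apply: wsum_ext => i; rewrite /wsum_add addrC. Qed.
Let add0 : left_id ((fun=> 0) : wsum) wsum_add.
Proof. by move=> X; apply: wsum_ext => i; rewrite /wsum_add add0r. Qed.
Let addN : left_inverse ((fun=> 0) : wsum) wsum_opp wsum_add.
Proof. by move=> X; apply: wsum_ext => i; rewrite /wsum_add addNr. Qed.

HB.instance Definition _ := GRing.isZmodule.Build wsum addA addC add0 addN.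

Lemma wsumD (X Y : wsum) i : (X + Y) i = X i + Y i. Proof. by []. Qed.
Lemma wsumB (X Y : wsum) i : (X - Y) i = X i - Y i. Proof. by []. Qed.

Let scaleA a b X : wsum_scale a (wsum_scale b X) = wsum_scale (a * b) X.
Proof. by apply: wsum_ext => i; rewrite /wsum_scale scalerA. Qed.
Let scale1 : left_id 1 wsum_scale.
Proof. by move=> X; apply: wsum_ext => i; rewrite /wsum_scale scale1r. Qed.
Let scaleDr : right_distributive wsum_scale +%R.
Proof.
by move=> a X Y; apply: wsum_ext => i; rewrite /wsum_scale wsumD scalerDr.
Qed.
Let scaleDl X : {morph wsum_scale^~ X : a b / a + b}.
Proof. by move=> a b; apply: wsum_ext => i; rewrite /wsum_scale scalerDl. Qed.

HB.instance Definition _ :=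
  GRing.Zmodule_isLmodule.Build R wsum scaleA scale1 scaleDr scaleDl.

Lemma wsumZ a (X : wsum) i : (a *: X) i = a *: X i. Proof. by []. Qed.

Definition wsum_inner (X Y : wsum) : R := \sum_i (w i)%:num * inner (X i) (Y i).

Let wsum_innerC X Y : wsum_inner X Y = wsum_inner Y X.
Proof. by apply: eq_bigr => i _; rewrite innerC. Qed.

Let wsum_innerB X : zmod_morphism (wsum_inner X).
Proof.
move=> Y Z; rewrite /wsum_inner -sumrB; apply: eq_bigr => i _.
by rewrite wsumB !innerE mulrBr.
Qed.

Let wsum_innerZ X : scalable_for (@idfun R \; *%R) (wsum_inner X).
Proof.
move=> a Y; rewrite /wsum_inner /= mulr_sumr; apply: eq_bigr => i _.
by rewrite wsumZ !innerE; ring.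
Qed.

Let wsum_innerBl Y : zmod_morphism (wsum_inner^~ Y).
Proof. by move=> X Z; rewrite !(wsum_innerC _ Y) wsum_innerB. Qed.

Let wsum_innerZl Y : scalable_for *%R (wsum_inner^~ Y).
Proof. by move=> a X; rewrite !(wsum_innerC _ Y) wsum_innerZ. Qed.

HB.instance Definition _ := isBilinear.Build R wsum wsum R *%R
  (@idfun R \; *%R) wsum_inner wsum_innerBl wsum_innerB wsum_innerZl
  wsum_innerZ.

Let wsum_inner_herm X Y :
  wsum_inner X Y = (-1) ^+ false * idfun (wsum_inner Y X).
Proof. by rewrite mul1r /= wsum_innerC. Qed.

HB.instance Definition _ := isHermitianSesquilinear.Build R wsum false idfun
  wsum_inner wsum_inner_herm.

Let sum_ge0 (X : wsum) : 0 <= wsum_inner X X.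
Proof.
by apply: sumr_ge0 => i _; rewrite mulr_ge0// -inner_norm exprn_ge0.
Qed.

Let sum_eq0 (X : wsum) : wsum_inner X X = 0 -> X = 0.
Proof.
move=> /psumr_eq0P X0; apply: wsum_ext => i; apply/inner_self_eq0.
have /eqP : (w i)%:num * inner (X i) (X i) = 0.
  by apply: X0 => // j _; rewrite mulr_ge0// -inner_norm exprn_ge0.
by rewrite mulf_eq0 gt_eqF//= => /eqP.
Qed.

Let wsum_inner_gt0 (X : wsum) : X != 0 -> 0 < wsum_inner X X.
Proof.
move=> X0; rewrite lt_neqAle sum_ge0 andbT eq_sym.
by apply: contra_neq X0; exact: sum_eq0.
Qed.

HB.instance Definition _ := isDotProduct.Build R wsum wsum_inner wsum_inner_gt0.

Definition wsum_norm (X : wsum) : R := Num.sqrt (wsum_inner X X).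

Let normD X Y : wsum_norm (X + Y) <= wsum_norm X + wsum_norm Y.
Proof.
rewrite -(ler_pXn2r (n := 2)) ?nnegrE ?addr_ge0 ?sqrtr_ge0//.
rewrite sqrrD !sqr_sqrtr ?sum_ge0//.
have -> : wsum_inner (X + Y) (X + Y) =
    wsum_inner X X + wsum_inner X Y *+ 2 + wsum_inner Y Y.
  by rewrite linearDl !linearDr /= (wsum_innerC Y X) mulr2n; ring.
rewrite lerD2r lerD2l lerMn2r /=.
apply: le_trans (ler_norm _) _.
rewrite -(ler_pXn2r (n := 2)) ?nnegrE ?mulr_ge0 ?sqrtr_ge0//.
rewrite exprMn !sqr_sqrtr ?sum_ge0// real_normK ?num_real//.
exact: (dot_cauchy_schwarz (wsum_inner : {dot wsum for idfun})).
Qed.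

Let normZ a X : wsum_norm (a *: X) = `|a| * wsum_norm X.
Proof.
rewrite /wsum_norm wsum_innerZl wsum_innerZ /= mulrA -expr2.
by rewrite sqrtrM ?sqr_ge0// sqrtr_sqr.
Qed.

Let norm0_eq0 X : wsum_norm X = 0 -> X = 0.
Proof.
move=> /eqP; rewrite sqrtr_eq0 => X0; apply: sum_eq0.
by apply/eqP; rewrite eq_le X0 sum_ge0.
Qed.

HB.instance Definition _ :=
  Lmodule_isNormed.Build R wsum normD normZ norm0_eq0.

Lemma wsum_sqr_norm (X : wsum) :
  `|X| ^+ 2 = \sum_i (w i)%:num * `|X i| ^+ 2.
Proof.
rewrite [LHS]sqr_sqrtr ?sum_ge0//.
by apply: eq_bigr => i _; rewrite inner_norm.
Qed.

Lemma wsum_norm_coord (X : wsum) i : Num.sqrt (w i)%:num * `|X i| <= `|X|.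
Proof.
rewrite -(ler_pXn2r (n := 2)) ?nnegrE ?mulr_ge0 ?sqrtr_ge0//.
rewrite exprMn sqr_sqrtr// wsum_sqr_norm (bigD1 i)//= lerDl.
by apply: sumr_ge0 => j _; rewrite mulr_ge0 ?exprn_ge0.
Qed.

(** With [wsum_norm_coord], this makes convergence and summability in the sum
    equivalent to convergence and summability of the coordinates. *)
Lemma wsum_norm_le_sum (X : wsum) :
  `|X| <= \sum_i Num.sqrt (w i)%:num * `|X i|.
Proof.
have s0 i : 0 <= Num.sqrt (w i)%:num * `|X i| by rewrite mulr_ge0 ?sqrtr_ge0.
rewrite -(ler_pXn2r (n := 2)) ?nnegrE ?sumr_ge0//.
have -> : `|X| ^+ 2 = \sum_i (Num.sqrt (w i)%:num * `|X i|) ^+ 2.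
  by rewrite wsum_sqr_norm; apply: eq_bigr => i _; rewrite exprMn sqr_sqrtr.
elim: (index_enum I) => [|i r IHr]; first by rewrite !big_nil expr0n.
rewrite !big_cons sqrrD.
have sr : 0 <= \sum_(j <- r) Num.sqrt (w j)%:num * `|X j|.
  by apply: sumr_ge0.
have := mulr_ge0 (s0 i) sr; lra.
Qed.

Lemma wsum_cvg {T : Type} (F : set_system T) (u : T -> wsum) (l : wsum) :
  Filter F -> (forall i, u t i @[t --> F] --> l i) -> u @ F --> l.
Proof.
move=> FF ul; apply/cvgrPdist_le => e e0.
pose s := \sum_i Num.sqrt (w i)%:num.
have s0 : 0 <= s by apply: sumr_ge0 => i _; exact: sqrtr_ge0.
have s1 : 0 < s + 1 by rewrite ltr_wpDl.
near=> t.
apply: le_trans (wsum_norm_le_sum _) _.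
apply: (@le_trans _ _ (\sum_i Num.sqrt (w i)%:num * (e / (s + 1)))).
  apply: ler_sum => i _; rewrite ler_wpM2l ?sqrtr_ge0//.
  move: i; near: t; apply: filter_forall => i.
  by apply: cvgr_dist_le (ul i) _ _; rewrite divr_gt0.
rewrite -mulr_suml -/s mulrCA ger_pMr// ler_pdivrMr// mul1r.
by rewrite lerDl.
Unshelve. all: by end_near. Qed.

Let wsum_complete (F : set_system wsum) : ProperFilter F -> cauchy F -> cvg F.
Proof.
move=> FF /cauchyP FC.
have Fi i : cauchy ((fun X : wsum => X i) @ F).
  apply/cauchyP => e e0.
  have w0 : 0 < Num.sqrt (w i)%:num by rewrite sqrtr_gt0.
  have [X FX] := FC _ (mulr_gt0 w0 e0).
  exists (X i); apply: (@filterS _ F _ _ _ _ FX) => Y.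
  rewrite /= -!ball_normE /= => XY.
  rewrite -(ltr_pM2l w0); apply: le_lt_trans XY.
  by have := wsum_norm_coord (X - Y) i; rewrite wsumB.
pose l : wsum := fun i => lim ((fun X : wsum => X i) @ F).
apply/cvg_ex; exists l.
apply: (@wsum_cvg _ F id) => i.
exact: (@cauchy_cvg (E i) _ _ (Fi i)).
Qed.

HB.instance Definition _ := Uniform_isComplete.Build wsum wsum_complete.

HB.instance Definition _ := hasInnerProduct.Build R wsum
  (fun X => sqr_sqrtr (sum_ge0 X)).

Lemma wsum_innerE (X Y : wsum) :
  inner X Y = \sum_i (w i)%:num * inner (X i) (Y i).
Proof. by []. Qed.

End HilbertSum.

(** * Maximally monotone operators *)

Section MaximalMonotone.
Context {R : realType} {K : hilbertType R}.
Implicit Type M : K -> set K.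

(** Otherwise [(x, u)] could be added to the graph. *)
Lemma maximally_monotone_related M x u : maximally_monotone M ->
  (forall y v, M y v -> 0 <= inner (x - y) (u - v)) -> M x u.
Proof.
move=> [monM maxM] rel; apply: contrapT => nMxu.
pose N : K -> set K := fun y => [set v | M y v \/ (y = x /\ v = u)].
apply: (maxM N).
- move=> [y v] [y' v']; rewrite /gra /N /= => -[Myv|[-> ->]] [Myv'|[-> ->]].
  + exact: (monM (y, v) (y', v')).
  + by rewrite -opprB -(opprB u) innerNl innerNr opprK; exact: rel.
  + exact: rel.
  + by rewrite !subrr inner0l.
- split; first by move=> [y v] Myv; left.
  by move=> /(_ (x, u)) sub; apply/nMxu/sub; right.
Qed.

Lemma maximally_monotoneI M : Defs.monotone M ->
  (forall x u, (forall y v, M y v -> 0 <= inner (x - y) (u - v)) -> M x u) ->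
  maximally_monotone M.
Proof.
move=> monM relM; split=> // N monN [MN]; apply=> -[x u] Nxu.
apply: relM => y v Myv.
by apply: (monN (x, u) (y, v)) => //; exact: (MN (y, v)).
Qed.

Lemma maximally_monotone_opinv M :
  maximally_monotone M -> maximally_monotone (opinv M).
Proof.
move=> maxM; apply: maximally_monotoneI.
  move=> [u x] [v y] Mxu Myv; rewrite innerC.
  by apply: (maxM.1 (x, u) (y, v)).
move=> u x rel; apply: (maximally_monotone_related maxM) => y v Myv.
by rewrite innerC; exact: rel.
Qed.

Lemma maximally_monotone_scale (g : R) M : 0 < g ->
  maximally_monotone M -> maximally_monotone (op_scale g M).
Proof.
move=> g0 maxM; apply: maximally_monotoneI.
  move=> [x u] [y v]; rewrite /gra /= => -[u' Mxu' <-] [v' Myv' <-].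
  rewrite -scalerBr innerZr mulr_ge0 ?(ltW g0)//.
  exact: (maxM.1 (x, u') (y, v')).
move=> x u rel; exists (g^-1 *: u); last first.
  by rewrite scalerA divff ?gt_eqF// scale1r.
apply: (maximally_monotone_related maxM) => y v Myv.
have -> : g^-1 *: u - v = g^-1 *: (u - g *: v).
  by rewrite scalerBr scalerA mulVf ?gt_eqF// scale1r.
rewrite innerZr mulr_ge0 ?invr_ge0 ?(ltW g0)//.
by apply: rel; exists v.
Qed.

(** Following Simons and Zalinescu, the proximal point is taken, in the square
    of the space, of the Fitzpatrick function of [M - y]: the supremum over
    [(a, c)] in the graph of [M] of [<x, c - y> + <a, u> - <a, c - y>].
    Maximality says that this function is at least [<x, u>] everywhere, with equality on
    the graph.  At its proximal point [(x0, u0)] the optimality condition,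
    tested on the graph, shows that [(- u0, - x0)] is monotonically related to
    the graph of [M - y] with a margin [|x0 + u0|^2].  So this pair lies in the
    graph, the margin vanishes, and [u0 = - x0]: the point [x0] is the one
    sought. *)
Lemma minty M y : maximally_monotone M -> exists p, M p (y - p).
Proof.
move=> maxM.
pose KK : hilbertType R :=
  weighted_sum (fun=> PosNum ltr01) (fun _ : bool => K).
pose mk (x u : K) : KK := fun i => if i then x else u.
have innerKK (X Y : KK) :
    inner X Y = inner (X true) (Y true) + inner (X false) (Y false).
  by rewrite wsum_innerE big_bool /= !mul1r.
have sqrKK (X : KK) : `|X| ^+ 2 = `|X true| ^+ 2 + `|X false| ^+ 2.
  by rewrite wsum_sqr_norm big_bool /= !mul1r.
pose gr := {q : K * K | M q.1 q.2}.
pose phi (q : gr) (X : KK) :=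
  inner X (mk ((sval q).2 - y) (sval q).1) - inner (sval q).1 ((sval q).2 - y).
have phiE a c (Mac : M a c) X : phi (exist _ (a, c) Mac) X =
    inner (X true) (c - y) + inner (X false) a - inner a (c - y).
  by rewrite /phi /= innerKK.
have alg (x u a c : K) (t : R) : inner x c + inner u a - inner a c <= t ->
    t < inner x u -> 0 <= inner (x - a) (u - c).
  by rewrite !innerE (innerC a u); lra.
(* maximality: the Fitzpatrick function dominates the duality pairing *)
have lb (X : KK) t : (forall q, phi q X <= t) -> inner (X true) (X false) <= t.
  move=> Xt; rewrite leNgt; apply/negP => lt_t.
  have Mx : M (X true) (X false + y).
    apply: (maximally_monotone_related maxM) => a c Mac.
    have := Xt (exist _ (a, c) Mac); rewrite phiE => le_t.
    have -> : X false + y - c = X false - (c - y) by rewrite opprB addrA addrAC.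
    exact: alg le_t lt_t.
  have := Xt (exist _ (_, _) Mx); rewrite phiE addrK (innerC (X false)).
  by rewrite addrK leNgt lt_t.
(* monotonicity: on the graph it is at most the duality pairing *)
have feas a c : M a c -> forall q, phi q (mk a (c - y)) <= inner a (c - y).
  move=> Mac [[a' c'] Mac']; rewrite phiE /=.
  have := maxM.1 (a, c) (a', c') Mac Mac'.
  have /= -> : c - c' = (c - y) - (c' - y) by rewrite opprB addrA subrK.
  by rewrite !innerE (innerC a' c) (innerC a' y); lra.
have [||||X0 [t0 [X0t0 vi]]] := @proximal_point R KK gr phi 0.
- move=> q X Y l _; rewrite /phi innerDl !innerZl.
  by rewrite le_eqVlt; apply/orP; left; apply/eqP; ring.
- move=> q; apply: (@lipschitz_continuous R KK R^o _
    `|mk ((sval q).2 - y) (sval q).1 : KK|) => X Y.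
  rewrite /phi opprB addrA subrK -innerNl -innerDl mulrC.
  exact: cauchy_schwarz.
- have [a [c Mac]] : exists a c, M a c.
    apply: contrapT => nM; apply: (nM); exists 0, 0.
    apply: (maximally_monotone_related maxM) => a c Mac.
    by exfalso; apply: nM; exists a, c.
  by exists (mk a (c - y)), (inner a (c - y)); exact: feas.
- move=> X t /lb Xt; rewrite sqrKK.
  by have := sqr_ge0 `|X true + X false|; rewrite sqr_normD; lra.
pose x0 : K := X0 true; pose u0 : K := X0 false.
have alg2 (a c : K) : inner x0 u0 <= t0 ->
    0 <= inner a c - t0 + (inner x0 (a - x0) + inner u0 (c - u0)) ->
    `|x0 + u0| ^+ 2 <= inner (- u0 - a) (- x0 - c).
  rewrite sqr_normD !inner_norm !innerE (innerC u0 x0) (innerC a x0); lra.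
have rel a c : M a c -> `|x0 + u0| ^+ 2 <= inner (- u0 - a) (y - x0 - c).
  move=> Mac; have := vi (mk a (c - y)) (inner a (c - y)).
  have -> : y - x0 - c = - x0 - (c - y) by rewrite opprB addrA (addrC (- x0)).
  move=> h; apply: alg2; first exact: lb X0t0.
  by have := h (feas _ _ Mac); rewrite innerKK.
have Mu0 : M (- u0) (y - x0).
  apply: (maximally_monotone_related maxM) => a c /rel; apply: le_trans.
  exact: exprn_ge0.
have := rel _ _ Mu0; rewrite subrr inner0l => x0u0.
have /eqP : `|x0 + u0| ^+ 2 = 0 by apply/eqP; rewrite eq_le x0u0 exprn_ge0.
rewrite sqrf_eq0 normr_eq0 addr_eq0 => /eqP x0E.
by exists x0; rewrite {1}x0E.
Qed.

Lemma J_resolvent M x : maximally_monotone M -> M (J M x) (x - J M x).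
Proof.
move=> maxM; have [p Mp] := minty x maxM.
have : resolvent M x (J M x).
  by apply: getPex; exists p, (x - p); rewrite // addrC subrK.
move=> [u Mu xE]; suff -> : x - J M x = u by [].
by rewrite -{1}xE addrC addKr.
Qed.

(** Weak convergence of one factor suffices when the other one converges
    strongly, provided that the former stays bounded. *)
Lemma weak_strong_inner {T : Type} (F : set_system T) (p q : T -> K) (x u : K)
    (C : R) : Filter F -> (forall t, `|p t| <= C) ->
  (forall y, inner (p t) y @[t --> F] --> inner x y) -> q @ F --> u ->
  inner (p t) (q t) @[t --> F] --> inner x u.
Proof.
move=> FF pC px qu.
rewrite (_ : (fun t => _) =
    (fun t => inner (p t) (q t - u)) \+ (fun t => inner (p t) u)); last first.
  by apply/funext => t /=; rewrite -innerDr subrK.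
rewrite -[X in _ --> X]add0r; apply: cvgD; last exact: px.
apply/norm_cvg0P.
have Cq : C * `|q t - u| @[t --> F] --> 0.
  rewrite -[X in _ --> X](mulr0 C); apply: cvgMl_tmp.
  by apply/norm_cvg0P; apply/subr_cvg0.
apply: (squeeze_cvgr _ (cvg_cst 0) Cq).
apply: nearW => t; rewrite normr_ge0/=.
by apply: le_trans (cauchy_schwarz _ _) _; rewrite ler_wpM2r.
Qed.

Lemma maximally_monotone_closed {T : Type} (F : set_system T) M
    (p q : T -> K) (x u : K) (C : R) :
  ProperFilter F -> maximally_monotone M -> (forall t, M (p t) (q t)) ->
  (forall t, `|p t| <= C) ->
  (forall y, inner (p t) y @[t --> F] --> inner x y) -> q @ F --> u ->
  M x u.
Proof.
move=> FF maxM Mpq pC px qu.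
apply: (maximally_monotone_related maxM) => y v Myv.
have pq_lim : inner (p t - y) (q t - v) @[t --> F] --> inner (x - y) (u - v).
  apply: (@weak_strong_inner _ F _ _ _ _ (C + `|y|)).
  - by move=> t; apply: le_trans (ler_normB _ _) _; rewrite lerD2r.
  - move=> z; under eq_cvg do rewrite innerDl innerNl.
    rewrite innerDl innerNl; apply: cvgB; [exact: px|exact: cvg_cst].
  - by apply: cvgB; [exact: qu|exact: cvg_cst].
apply: (cvgr_to_ge pq_lim); apply: nearW => t.
exact: (maxM.1 (p t, q t) (y, v) (Mpq t) Myv).
Qed.

End MaximalMonotone.

(** * Quasi-Fejer sequences and Opial's argument *)

Section QuasiFejer.
Context {R : realType}.

(** Subtracting the partial sums of the errors makes [D] nonincreasing. *)
Lemma quasi_fejer_cvg (D e : nat -> R) :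
  (forall n, 0 <= D n) -> (forall n, 0 <= e n) -> cvgn (series e) ->
  (forall n, D n.+1 <= D n + e n) -> cvgn D.
Proof.
move=> D0 e0 ecvg De.
have -> : D = (D \- series e) \+ series e.
  by apply/funext => n /=; rewrite subrK.
apply: is_cvgD => //; apply: nonincreasing_is_cvgn.
  apply/nonincreasing_seqP => n /=.
  by have := De n; rewrite /series /= big_nat_recr//=; lra.
exists (- limn (series e)) => _ [n _ <-] /=.
have : series e n <= limn (series e).
  apply: nondecreasing_cvgn_le => //.
  by apply/nondecreasing_seqP => k; rewrite /series/= big_nat_recr//= lerDl.
by have := D0 n; lra.
Qed.

End QuasiFejer.

Section Opial.
Context {R : realType} {K : hilbertType R}.

(** If [l] and [l'] are two weak cluster points in [Z], then
    [|x n - l'|^2 - |x n - l|^2] converges, hence so does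
    [inner (x n) (l - l')].  Computing this limit along two ultrafilters gives
    [inner l (l - l') = inner l' (l - l')], that is [l = l']. *)
Lemma opial (Z : set K) (x : nat -> K) :
  (forall z, Z z -> cvgn (fun n => `|x n - z|)) ->
  (forall U, UltraFilter U -> \oo `<=` U ->
     exists2 l, Z l & forall y, inner (x n) y @[n --> U] --> inner l y) ->
  exists2 l, Z l & weak_cvg x l.
Proof.
move=> fejer cluster.
have uniq_lim U V l l' : UltraFilter U -> \oo `<=` U -> UltraFilter V ->
    \oo `<=` V -> Z l -> Z l' ->
    (forall y, inner (x n) y @[n --> U] --> inner l y) ->
    (forall y, inner (x n) y @[n --> V] --> inner l' y) -> l = l'.
  move=> UU oU UV oV Zl Zl' xl xl'.
  have UP : ProperFilter U by exact: ultra_proper.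
  have VP : ProperFilter V by exact: ultra_proper.
  have /cvg_ex[s xs] : cvgn (fun n => inner (x n) (l - l')).
    have -> : (fun n => inner (x n) (l - l')) = (fun n => 2^-1 *
        (`|x n - l'| * `|x n - l'| - `|x n - l| * `|x n - l| +
         (`|l| ^+ 2 - `|l'| ^+ 2))).
      apply/funext => n; rewrite -!expr2 !sqr_normB innerDr innerNr.
      by field.
    apply: is_cvgMl_tmp; apply: is_cvgD; last exact: is_cvg_cst.
    by apply: is_cvgB; apply: is_cvgM; exact: fejer.
  have sl : inner l (l - l') = s.
    by apply: norm_cvg_unique (xl _) _; exact: cvg_trans (cvg_app _ oU) xs.
  have sl' : inner l' (l - l') = s.
    by apply: norm_cvg_unique (xl' _) _; exact: cvg_trans (cvg_app _ oV) xs.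
  apply/eqP; rewrite -subr_eq0; apply/eqP/inner_self_eq0.
  by rewrite {1}innerDl innerNl sl sl' subrr.
have [U [UU oU]] := @ultraFilterLemma nat \oo _.
have [l Zl xl] := cluster U UU oU.
exists l => // y; apply: ultra_cvgP => V UV oV.
have [l' Zl' xl'] := cluster V UV oV.
by rewrite (uniq_lim U V l l').
Qed.

End Opial.

(** * The forward-backward-forward method *)

Section Descent.
Context {R : realType} {K : hilbertType R}.
Implicit Types (A : K -> set K) (S : K -> K).

Definition op_add A S : K -> set K := fun x => [set u + S x | u in A x].

(** Write [e = u + S p], so that the update is [x - g e].  The square of its
    distance to [z] is
      [|x - z|^2 - 2 g <p - z, e> - |x - p|^2 + |x - p - g e|^2],
    in which [x - p - g e = g (S x - S p + a)] is controlled by the Lipschitz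
    constant of [S].  The step size makes this last term smaller than
    [|x - p|^2] up to the error [a], and monotonicity of [S] replaces [S p] by
    [S z] in the inner product. *)
Lemma fbf_descent S (beta eps g : R) (x p a u z : K) :
  (forall s t, `|S s - S t| <= beta * `|s - t|) ->
  (forall s t, 0 <= inner (s - t) (S s - S t)) ->
  0 < eps <= 1 -> 0 <= g -> g * beta <= 1 - eps ->
  p + g *: u = x - g *: (S x + a) ->
  `|x - g *: (u + S p) - z| ^+ 2 + eps * `|x - p| ^+ 2 +
    2 * g * inner (p - z) (u + S z) <= `|x - z| ^+ 2 + (g * `|a|) ^+ 2 / eps.
Proof.
move=> lipS monS /andP[eps0 eps1] g0 gbeta pE.
have E1 : x - p - g *: (u + S p) = g *: (S x - S p + a).
  rewrite scalerDr opprD addrA -(addrA x) -opprD pE subKr -scalerBr.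
  by rewrite addrAC.
have d_le : `|g *: (S x - S p + a)| <= (1 - eps) * `|x - p| + g * `|a|.
  rewrite normrZ ger0_norm//.
  apply: (@le_trans _ _ (g * (beta * `|x - p| + `|a|))).
    by rewrite ler_wpM2l// (le_trans (ler_normD _ _))// lerD2r.
  by rewrite mulrDr mulrA lerD2r ler_wpM2r.
(* convexity of the square, [g |a|] being [eps] times [g |a| / eps] *)
have sq_le : `|g *: (S x - S p + a)| ^+ 2 <=
    (1 - eps) * `|x - p| ^+ 2 + (g * `|a|) ^+ 2 / eps.
  set d := `|x - p| in d_le *; set al := g * `|a| in d_le *.
  apply: (@le_trans _ _ (((1 - eps) * d + al) ^+ 2)).
    by rewrite ler_pXn2r ?nnegrE// (le_trans _ d_le).
  rewrite -subr_ge0 [leRHS](_ : _ = (1 - eps) / eps * (eps * d - al) ^+ 2).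
    by rewrite mulr_ge0 ?sqr_ge0// divr_ge0 ?(ltW eps0)// subr_ge0.
  by field; rewrite gt_eqF.
have := monS p z.
have E2 : `|x - g *: (u + S p) - z| ^+ 2 = `|x - z| ^+ 2 +
    `|x - p - g *: (u + S p)| ^+ 2 - `|x - p| ^+ 2
    - 2 * g * inner (p - z) (u + S p).
  move: (u + S p) => v; rewrite !inner_norm !innerE.
  rewrite (innerC p x) (innerC z x) (innerC v x) (innerC v z) (innerC v p).
  by ring.
rewrite E2 E1 => monpz.
have : inner (p - z) (u + S z) = inner (p - z) (u + S p) -
    inner (p - z) (S p - S z).
  by rewrite !innerDr !innerNr; ring.
nra.
Qed.

End Descent.

Section ForwardBackwardForward.
Context {R : realType} {K : hilbertType R}.
Variables (A : K -> set K) (S : K -> K) (beta eps : R) (g : nat -> R).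
Variables (a b c x y p q : nat -> K).
Hypotheses (monA : Defs.monotone A) (maxAS : maximally_monotone (op_add A S)).
Hypothesis monS : forall s t, 0 <= inner (s - t) (S s - S t).
Hypothesis lipS : forall s t, `|S s - S t| <= beta * `|s - t|.
Hypotheses (beta_gt0 : 0 < beta) (eps_gt0 : 0 < eps) (eps_le1 : eps <= 1).
Hypothesis g_ge : forall n, eps <= g n.
Hypothesis g_le : forall n, g n * beta <= 1 - eps.
Hypotheses (a_sum : absolutely_summable a) (b_sum : absolutely_summable b)
  (c_sum : absolutely_summable c).
Hypothesis yE : forall n, y n = x n - g n *: (S (x n) + a n).
Hypothesis pE : forall n, resolvent (op_scale (g n) A) (y n) (p n - b n).
Hypothesis qE : forall n, q n = p n - g n *: (S (p n) + c n).
Hypothesis xE : forall n, x n.+1 = x n - y n + q n.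

(** The exact resolvent point is [pe n = p n - b n], and [xe n] is the update
    computed from it without the errors [b n] and [c n].  The error [a n] is
    kept inside the descent inequality, so that no second, unperturbed resolvent has
    to be compared with the first.  The last three conclusions feed the proof of
    strong convergence: since [- S xbar] is a value of [A] at [xbar], the last
    one says that the monotonicity inequality of [A] between [p n - b n] and [xbar]
    becomes an equality in the limit. *)
Lemma forward_backward_forward_cvg :
  (exists z, op_add A S z 0) ->
  exists xbar (u : nat -> K), [/\ op_add A S xbar 0, weak_cvg x xbar,
    x n - (p n - b n) @[n --> \oo] --> (0 : K),
    forall n, A (p n - b n) (u n) &
    inner (p n - b n - xbar) (u n + S xbar) @[n --> \oo] --> (0 : R)].
Proof.
move=> [z0 Zz0].
pose pe n := p n - b n.
have /choice[u uP] : forall n, exists u, A (pe n) u /\ pe n + g n *: u = y n.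
  by move=> n; have [_ [u Au <-] puy] := pE n; exists u.
have Au n : A (pe n) (u n) by have [] := uP n.
have puE n : pe n + g n *: u n = y n by have [] := uP n.
have g0 n : 0 < g n by exact: lt_le_trans (g_ge n).
have g_inv n : g n <= beta^-1.
  rewrite -(ler_pM2r beta_gt0) mulVf ?gt_eqF//.
  by apply: le_trans (g_le n) _; rewrite gerBl ltW.
pose xe n := x n - g n *: (u n + S (pe n)).
pose al n := beta^-1 * `|a n|.
pose de n := 2 * `|b n| + beta^-1 * `|c n|.
have xe_close n : `|x n.+1 - xe n| <= de n.
  have -> : x n.+1 - xe n = b n - g n *: (S (p n) - S (pe n)) - g n *: c n.
    rewrite xE qE -puE /xe /pe; apply: inner_inj => z.
    by rewrite !innerE; ring.
  apply: le_trans (ler_normB _ _) _; apply: lerD; last first.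
    by rewrite normrZ gtr0_norm// ler_wpM2r.
  apply: le_trans (ler_normB _ _) _; rewrite normrZ gtr0_norm//.
  have := lipS (p n) (pe n); rewrite [p n - _]subKr => h.
  have gb : g n * beta * `|b n| <= `|b n|.
    by rewrite ler_piMl// (le_trans (g_le n))// gerBl ltW.
  by have := ler_wpM2l (ltW (g0 n)) h; rewrite mulrA; lra.
have al_ge0 n : 0 <= al n by rewrite mulr_ge0 ?invr_ge0 ?(ltW beta_gt0).
have de_ge0 n : 0 <= de n.
  by rewrite addr_ge0 ?mulr_ge0 ?invr_ge0 ?(ltW beta_gt0).
have al_sum : cvgn (series al) by apply: is_cvg_seriesZ.
have de_sum : cvgn (series de).
  by apply: is_cvg_seriesD; apply: is_cvg_seriesZ.
have al0 : al @ \oo --> 0 by exact: cvg_series_cvg_0.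
have de0 : de @ \oo --> 0 by exact: cvg_series_cvg_0.
have zeroP z : op_add A S z 0 -> A z (- S z).
  by move=> [v Av] /eqP; rewrite addr_eq0 => /eqP <-.
pose gap z n := inner (pe n - z) (u n + S z).
have gap_ge0 z n : op_add A S z 0 -> 0 <= gap z n.
  move=> /zeroP Az; have := monA (Au n : gra A (pe n, u n)) (Az : gra A (z, _)).
  by rewrite /= opprK.
(* dropping from [g n] to [eps] makes the last term uniform in [n] *)
have descent z n : op_add A S z 0 ->
    `|xe n - z| ^+ 2 + eps * `|x n - pe n| ^+ 2 + 2 * eps * gap z n <=
    `|x n - z| ^+ 2 + al n ^+ 2 / eps.
  move=> Zz; have ge := gap_ge0 z n Zz.
  have e01 : 0 < eps <= 1 by rewrite eps_gt0.
  have pue : pe n + g n *: u n = x n - g n *: (S (x n) + a n) by rewrite puE yE.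
  have := fbf_descent z lipS monS e01 (ltW (g0 n)) (g_le n) pue.
  rewrite -/(xe n) -/(gap z n) => h.
  have ga : (g n * `|a n|) ^+ 2 / eps <= al n ^+ 2 / eps.
    rewrite ler_pM2r ?invr_gt0// ler_pXn2r ?nnegrE ?mulr_ge0 ?(ltW (g0 n))//.
      by rewrite ler_wpM2r.
    by rewrite invr_ge0 ltW.
  by have := ler_wpM2r ge (g_ge n); lra.
(* the decrease of the squared distance, up to the error *)
pose r z n := `|x n - z| ^+ 2 + al n ^+ 2 / eps - `|xe n - z| ^+ 2.
have fejer z : op_add A S z 0 -> cvgn (fun n => `|x n - z|).
  move=> Zz.
  apply: (@quasi_fejer_cvg _ _ (fun n => eps^-1 * al n + de n)) => //.
  - by move=> n; rewrite addr_ge0// mulr_ge0 ?invr_ge0 ?(ltW eps_gt0).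
  - by apply: is_cvg_seriesD => //; exact: is_cvg_seriesZ.
  move=> n.
  have : `|xe n - z| <= `|x n - z| + eps^-1 * al n.
    have k0 : 0 <= eps^-1 * al n by rewrite mulr_ge0 ?invr_ge0 ?(ltW eps_gt0).
    rewrite -(ler_pXn2r (n := 2)) ?nnegrE ?addr_ge0//.
    have := descent z n Zz.
    have -> : al n ^+ 2 / eps = eps * (eps^-1 * al n) ^+ 2.
      by field; rewrite gt_eqF.
    have := mulr_ge0 (ltW eps_gt0) (gap_ge0 z n Zz).
    have := mulr_ge0 (ltW eps_gt0) (sqr_ge0 `|x n - pe n|).
    have := ler_wpM2r (sqr_ge0 (eps^-1 * al n)) eps_le1.
    have := mulr_ge0 (normr_ge0 (x n - z)) k0.
    by rewrite sqrrD; lra.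
  by have := xe_close n; have := ler_distD (xe n) (x n.+1) z; lra.
have r0 z : op_add A S z 0 -> r z @ \oo --> 0.
  move=> /fejer/cvg_ex[l xl].
  have xel : `|xe n - z| @[n --> \oo] --> l.
    have xl1 : `|x n.+1 - z| @[n --> \oo] --> l.
      by have := xl; rewrite -(cvg_shiftS (fun n => `|x n - z|)).
    have h1 : `|x n.+1 - z| - de n @[n --> \oo] --> l.
      by rewrite -[X in _ --> X]subr0; exact: cvgB.
    have h2 : `|x n.+1 - z| + de n @[n --> \oo] --> l.
      by rewrite -[X in _ --> X]addr0; exact: cvgD.
    apply: (squeeze_cvgr _ h1 h2); apply: nearW => n.
    have := xe_close n.
    have := ler_distD (xe n) (x n.+1) z; have := ler_distD (x n.+1) (xe n) z.
    by rewrite (distrC (xe n) (x n.+1)); lra.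
  have -> : (0 : R) = l * l + 0 * 0 / eps - l * l by rewrite !mul0r addr0 subrr.
  apply: cvgB; last exact: cvgM.
  by apply: cvgD; [exact: cvgM | apply: cvgMr_tmp; exact: cvgM].
have scaled_r0 k z : op_add A S z 0 -> k * r z n @[n --> \oo] --> 0.
  by move=> Zz; rewrite -[X in _ --> X](mulr0 k); apply: cvgMl_tmp; exact: r0.
have xpe0 : `|x n - pe n| @[n --> \oo] --> 0.
  have sqr0 : `|x n - pe n| ^+ 2 @[n --> \oo] --> 0.
    apply: (squeeze_cvgr _ (cvg_cst 0) (scaled_r0 eps^-1 z0 Zz0)).
    apply: nearW => n; rewrite sqr_ge0/= ler_pdivlMl//.
    have := mulr_ge0 (ltW eps_gt0) (gap_ge0 z0 n Zz0).
    by have := descent z0 n Zz0; rewrite /r; lra.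
  rewrite (_ : (fun n => _) = (fun n => Num.sqrt (`|x n - pe n| ^+ 2))).
    by rewrite -(sqrtr0 R); exact: (cvg_comp _ _ sqr0 (@sqrt_continuous R 0)).
  by apply/funext => n; rewrite sqrtr_sqr ger0_norm.
have gap0 z : op_add A S z 0 -> gap z @ \oo --> 0.
  move=> Zz; apply: (squeeze_cvgr _ (cvg_cst 0) (scaled_r0 (2 * eps)^-1 z Zz)).
  apply: nearW => n; rewrite gap_ge0//= ler_pdivlMl ?mulr_gt0//.
  have := mulr_ge0 (ltW eps_gt0) (sqr_ge0 `|x n - pe n|).
  by have := descent z n Zz; rewrite /r; lra.
have bounded (f : nat -> R) : cvgn f -> exists C, forall n, `|f n| <= C.
  by move=> /cvg_seq_bounded/pinfty_ex_gt0[C _ fC]; exists C => n; exact: fC.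
have [C xC] : exists C, forall n, `|x n| <= C.
  have [C zC] := bounded _ (fejer z0 Zz0).
  exists (C + `|z0|) => n; have := zC n; rewrite normr_id => h.
  rewrite -(subrK z0 (x n)); apply: le_trans (ler_normD _ _) _.
  by rewrite lerD2r.
have [D peD] : exists D, forall n, `|pe n| <= D.
  have [D dD] := bounded _ (cvgP _ xpe0).
  exists (D + C) => n; have := dD n; rewrite normr_id distrC => h.
  rewrite -(subrK (x n) (pe n)); apply: le_trans (ler_normD _ _) _.
  by rewrite lerD.
(* values of [A + S] at [pe n] that tend to [0] *)
pose v n := u n + S (pe n).
have v0 : v @ \oo --> (0 : K).
  apply/norm_cvg0P.
  have a0 : `|a n| @[n --> \oo] --> 0 by exact: cvg_series_cvg_0.
  have ub : (eps^-1 + beta) * `|x n - pe n| + `|a n| @[n --> \oo] --> 0.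
    rewrite -[X in _ --> X]addr0; apply: cvgD => //.
    by rewrite -[X in _ --> X](mulr0 (eps^-1 + beta)); exact: cvgMl_tmp.
  apply: (squeeze_cvgr _ (cvg_cst 0) ub); apply: nearW => n.
  rewrite normr_ge0/=.
  have -> : v n = (g n)^-1 *: (x n - pe n) - (S (x n) - S (pe n)) - a n.
    have -> : x n - pe n = g n *: (u n + (S (x n) + a n)).
      have := puE n; rewrite yE => /(canRL (addrK _)) ->.
      by rewrite scalerDr; apply: inner_inj => z; rewrite !innerE; ring.
    rewrite scalerA mulVf ?gt_eqF// scale1r.
    by apply: inner_inj => z; rewrite !innerE; ring.
  apply: le_trans (ler_normB _ _) _; rewrite lerD2r mulrDl.
  apply: le_trans (ler_normB _ _) _; apply: lerD; last exact: lipS.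
  rewrite normrZ gtr0_norm ?invr_gt0// ler_wpM2r// lef_pV2 ?posrE//.
have [|xbar Zxbar xxbar] := @opial _ _ [set z | op_add A S z 0] x fejer.
  move=> U UU oU; have UP : ProperFilter U by exact: ultra_proper.
  have [l xl] := ultra_weak_limit UU xC.
  exists l => //; apply: (maximally_monotone_closed UP maxAS _ peD).
  - by move=> n; exists (u n) => //; exact: Au.
  - move=> s; have -> : (fun n => inner (pe n) s) =
        (fun n => inner (x n) s) \- (fun n => inner (x n - pe n) s).
      by apply/funext => n /=; rewrite innerDl innerNl opprB addrC subrK.
    rewrite -[X in _ --> X]subr0; apply: cvgB; first exact: xl.
    apply/norm_cvg0P; have ub : `|x n - pe n| * `|s| @[n --> U] --> 0.
      rewrite -[X in _ --> X](mul0r `|s|); apply: cvgMr_tmp.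
      exact: cvg_trans (cvg_app _ oU) xpe0.
    apply: (squeeze_cvgr _ (cvg_cst 0) ub); apply: nearW => n.
    by rewrite normr_ge0; exact: cauchy_schwarz.
  - exact: cvg_trans (cvg_app _ oU) v0.
exists xbar, u; split => //.
- by apply/norm_cvg0P.
- exact: gap0.
Qed.

End ForwardBackwardForward.

(** * Bounded operators and coordinates of Hilbert sums *)

Section BoundedOperators.
Context {R : realType} {H G : hilbertType R} (L : {linear H -> G}).
Hypothesis L_bounded : bounded_near L (nbhs (0 : H)).

Lemma opnorm_ge0 : 0 <= opnorm L.
Proof.
have [C C0 LC] := pinfty_ex_gt0 ((linear_boundedP L).1 L_bounded).
apply: ub_le_sup; last by exists 0; rewrite /= ?normr0// linear0 normr0.
exists C => _ [x /= x1 <-]; apply: le_trans (LC x) _.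
by rewrite ler_piMr// ltW.
Qed.

Lemma opnorm_le x : `|L x| <= opnorm L * `|x|.
Proof.
have [C C0 LC] := pinfty_ex_gt0 ((linear_boundedP L).1 L_bounded).
have [->|x0] := eqVneq x 0; first by rewrite linear0 !normr0 mulr0.
have nx : 0 < `|x| by rewrite normr_gt0.
have nx' : 0 < `|x|^-1 by rewrite invr_gt0.
rewrite -ler_pdivrMr// mulrC -[X in X * _](gtr0_norm nx').
rewrite -normrZ -linearZ; apply: ub_le_sup.
  exists C => _ [y /= y1 <-]; apply: le_trans (LC y) _.
  by rewrite ler_piMr// ltW.
exists (`|x|^-1 *: x) => //=.
by rewrite normrZ normfV normr_id mulVf ?gt_eqF.
Qed.

Lemma adjointD v v' : adjoint L (v + v') = adjoint L v + adjoint L v'.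
Proof.
apply: inner_inj => x; rewrite innerDl !(innerC _ x) -!adjointP//.
by rewrite innerDr.
Qed.

Lemma adjointZ k v : adjoint L (k *: v) = k *: adjoint L v.
Proof.
apply: inner_inj => x; rewrite innerZl !(innerC _ x) -!adjointP//.
by rewrite innerZr.
Qed.

Lemma adjointB v v' : adjoint L (v - v') = adjoint L v - adjoint L v'.
Proof. by rewrite adjointD -scaleN1r adjointZ scaleN1r. Qed.

(** [|L^* v|^2 = <L (L^* v), v>], so one factor [|L^* v|] cancels. *)
Lemma adjoint_le v : `|adjoint L v| <= opnorm L * `|v|.
Proof.
have [->|a0] := eqVneq (adjoint L v) 0.
  by rewrite normr0 mulr_ge0 ?opnorm_ge0.
have na : 0 < `|adjoint L v| by rewrite normr_gt0.
rewrite -(ler_pM2r na) -expr2 inner_norm -adjointP//.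
apply: le_trans (ler_norm _) _; apply: le_trans (cauchy_schwarz _ _) _.
by rewrite mulrAC ler_wpM2r// opnorm_le.
Qed.

End BoundedOperators.

Section Coordinates.
Context {R : realType} {I : finType} (w : I -> {posnum R}).
Context (E : I -> hilbertType R).
Local Notation K := (weighted_sum w E).

(** The coordinate is tested against [y] by testing the whole vector against
    [y] placed in coordinate [i]. *)
Lemma weak_cvg_coord (u : nat -> K) (l : K) i :
  weak_cvg u l -> weak_cvg (fun n => u n i) (l i).
Proof.
move=> ul y.
pose Y : K := @dfwith I (fun j => E j) (fun=> 0) i y.
have YE (X : K) : inner X Y = (w i)%:num * inner (X i) y.
  rewrite wsum_innerE (bigD1 i)//= /Y dfwithin big1 ?addr0// => j ji.
  by rewrite dfwithout 1?eq_sym// inner0r mulr0.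
have yE (X : K) : inner (X i) y = (w i)%:num^-1 * inner X Y.
  by rewrite YE mulrA mulVf ?mul1r// gt_eqF.
rewrite yE (_ : (fun n => _) = (fun n => (w i)%:num^-1 * inner (u n) Y)).
  by apply: cvgMl_tmp; exact: ul.
by apply/funext => n; exact: yE.
Qed.

Lemma cvg0_coord {T : Type} (F : set_system T) (u : T -> K) i :
  Filter F -> u @ F --> (0 : K) -> u t i @[t --> F] --> (0 : E i).
Proof.
move=> FF u0; apply/norm_cvg0P.
have w0 : 0 < Num.sqrt (w i)%:num by rewrite sqrtr_gt0.
have ub : (Num.sqrt (w i)%:num)^-1 * `|u t| @[t --> F] --> 0.
  rewrite -[X in _ --> X](mulr0 (Num.sqrt (w i)%:num)^-1); apply: cvgMl_tmp.
  exact/norm_cvg0P.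
apply: (squeeze_cvgr _ (cvg_cst 0) ub); apply: nearW => t.
by rewrite normr_ge0/= ler_pdivlMl//; exact: wsum_norm_coord.
Qed.

Lemma absolutely_summable_coord (a : nat -> K) :
  (forall i, absolutely_summable (fun n => a n i)) -> absolutely_summable a.
Proof.
move=> ai; pose s r n := \sum_(i <- r) Num.sqrt (w i)%:num * `|a n i|.
have s_cvg r : cvgn (series (s r)).
  elim: r => [|i r IHr].
    rewrite (_ : series _ = fun=> 0); first exact: is_cvg_cst.
    by apply/funext => n; rewrite /series/= big1// => k _; rewrite /s big_nil.
  rewrite (_ : s _ = (fun n => Num.sqrt (w i)%:num * `|a n i|) \+ s r).
    by apply: is_cvg_seriesD => //; apply: is_cvg_seriesZ; exact: ai.
  by apply/funext => n; rewrite /s big_cons.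
apply: series_le_cvg (s_cvg (index_enum I)) => n.
- exact: normr_ge0.
- by rewrite /s; apply: sumr_ge0 => i _; rewrite mulr_ge0 ?sqrtr_ge0.
- exact: wsum_norm_le_sum.
Qed.

End Coordinates.

(** * The primal-dual operator *)

Lemma affine_ge0_slope (R : realType) (k0 k1 : R) :
  (forall t, 0 <= k0 + t * k1) -> k1 = 0.
Proof.
move=> ge0; apply/eqP/negPn/negP => k10.
have := ge0 (- (k0 + 1) / k1); rewrite mulfVK//; lra.
Qed.

(** A condition on the weighted sum splits into conditions on the summands: by
    maximality each summand can be made nonpositive by some point of the graph
    of [B i], and even negative unless [(s i, v i)] already lies in it. *)
Lemma maximally_monotone_family (R : realType) (I : finType) (w : I -> R)
    (G : I -> hilbertType R) (B : forall i, G i -> set (G i))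
    (s v : forall i, G i) :
  (forall i, 0 < w i) -> (forall i, maximally_monotone (B i)) ->
  (forall c d : forall i, G i, (forall i, B i (c i) (d i)) ->
     0 <= \sum_i w i * inner (s i - c i) (v i - d i)) ->
  forall i, B i (s i) (v i).
Proof.
move=> w0 maxB rel.
have ex i : {q : G i * G i | B i q.1 q.2 /\
    inner (s i - q.1) (v i - q.2) <= 0 /\
    (inner (s i - q.1) (v i - q.2) = 0 -> B i (s i) (v i))}.
  apply: cid; have [Bsv|nB] := pselect (B i (s i) (v i)).
    by exists (s i, v i); rewrite /= subrr inner0l.
  apply: contrapT => nex; apply: nB.
  apply: (maximally_monotone_related (maxB i)) => c d Bcd.
  rewrite leNgt; apply/negP => lt0; apply: nex; exists (c, d) => /=.
  by split=> //; split; [exact: ltW | move=> e0; move: lt0; rewrite e0 ltxx].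
pose c i := (sval (ex i)).1; pose d i := (sval (ex i)).2.
have cdP i := svalP (ex i).
have le0 i : w i * inner (s i - c i) (v i - d i) <= 0.
  by rewrite pmulr_rle0//; have [_ []] := cdP i.
have sum0 : \sum_i - (w i * inner (s i - c i) (v i - d i)) = 0.
  apply/eqP; rewrite eq_le sumr_ge0 ?andbT => [|i _]; last by rewrite oppr_ge0.
  rewrite sumrN oppr_le0; apply: rel => i.
  by have [] := cdP i.
move=> i; have [_ [_]] := cdP i; apply.
move/psumr_eq0P in sum0.
have /eqP : - (w i * inner (s i - c i) (v i - d i)) = 0.
  by apply: sum0 => // j _; rewrite oppr_ge0.
by rewrite oppr_eq0 mulf_eq0 gt_eqF//= => /eqP.
Qed.

Section PrimalDual.
Context {R : realType} {H : hilbertType R} {m : nat}.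
Variables (z : H) (w : 'I_m -> R) (w_gt0 : forall i, 0 < w i).
Variables (G : 'I_m -> hilbertType R) (r : forall i, G i).
Variables (B : forall i, G i -> set (G i)) (L : forall i, {linear H -> G i}).
Arguments B : clear implicits.
Hypothesis w_sum : \sum_(i < m) w i = 1.
Hypothesis L_bounded : forall i, bounded_near (L i) (nbhs (0 : H)).

Definition pd_weight (j : 'I_m + 'I_m) : {posnum R} :=
  match j with inl i => PosNum (w_gt0 i) | inr i => PosNum (w_gt0 i) end.
Definition pd_factor (j : 'I_m + 'I_m) : hilbertType R :=
  match j with inl _ => H | inr i => G i end.
Definition pd_space : hilbertType R := weighted_sum pd_weight pd_factor.

Definition pd_pair (X : 'I_m -> H) (V : forall i, G i) : pd_space :=
  fun j => match j return pd_factor j with inl i => X i | inr i => V i end.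
Definition pd_primal (P : pd_space) (i : 'I_m) : H := P (inl i).
Definition pd_dual (P : pd_space) (i : 'I_m) : G i := P (inr i).

Lemma pd_innerE (P Q : pd_space) : inner P Q =
  \sum_i w i * inner (pd_primal P i) (pd_primal Q i) +
  \sum_i w i * inner (pd_dual P i) (pd_dual Q i).
Proof. by rewrite wsum_innerE big_sumType. Qed.

Lemma pd_ext (P Q : pd_space) :
  (forall i, pd_primal P i = pd_primal Q i) ->
  (forall i, pd_dual P i = pd_dual Q i) -> P = Q.
Proof.
move=> PQ1 PQ2; apply: functional_extensionality_dep => -[i|i].
- exact: PQ1.
- exact: PQ2.
Qed.

Lemma pd_primalD P Q i : pd_primal (P + Q) i = pd_primal P i + pd_primal Q i.
Proof. by []. Qed.
Lemma pd_dualD P Q i : pd_dual (P + Q) i = pd_dual P i + pd_dual Q i.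
Proof. by []. Qed.
Lemma pd_primalN P i : pd_primal (- P) i = - pd_primal P i.
Proof. by []. Qed.
Lemma pd_dualN P i : pd_dual (- P) i = - pd_dual P i.
Proof. by []. Qed.
Lemma pd_primalZ k P i : pd_primal (k *: P) i = k *: pd_primal P i.
Proof. by []. Qed.
Lemma pd_dualZ k P i : pd_dual (k *: P) i = k *: pd_dual P i.
Proof. by []. Qed.
Lemma pd_primal_pair X V i : pd_primal (pd_pair X V) i = X i.
Proof. by []. Qed.
Lemma pd_dual_pair X V i : pd_dual (pd_pair X V) i = V i.
Proof. by []. Qed.

Definition pdE := (pd_primalD, pd_dualD, pd_primalN, pd_dualN, pd_primalZ,
  pd_dualZ, pd_primal_pair, pd_dual_pair).

Definition pd_skew (P : pd_space) : pd_space :=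
  pd_pair (fun i => adjoint (L i) (pd_dual P i))
    (fun i => - L i (pd_primal P i)).

Lemma pd_primal_skew P i :
  pd_primal (pd_skew P) i = adjoint (L i) (pd_dual P i).
Proof. by []. Qed.
Lemma pd_dual_skew P i : pd_dual (pd_skew P) i = - L i (pd_primal P i).
Proof. by []. Qed.

(** This is [(N - z) x prod_i (r_i + B_i^-1)], where [N] is the normal cone of
    the diagonal.  The orthogonal complement of the diagonal consists of the
    families with weighted sum [0]; since the weights add up to [1], subtracting
    [z] from each member turns this sum into [- z]. *)
Definition pd_op (P : pd_space) : set pd_space := [set U |
  [/\ exists x, forall i, pd_primal P i = x,
      \sum_i w i *: pd_primal U i = - z &
      forall i, B i (pd_dual U i - r i) (pd_dual P i)]].

Lemma pd_skewB P Q : pd_skew P - pd_skew Q = pd_skew (P - Q).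
Proof.
apply: pd_ext => i; rewrite !(pd_primal_skew, pd_dual_skew, pdE).
  exact/esym/adjointB.
by rewrite linearB opprB opprK addrC.
Qed.

Lemma pd_skew_inner P : inner P (pd_skew P) = 0.
Proof.
rewrite pd_innerE -big_split big1// => i _.
rewrite pd_primal_skew pd_dual_skew /=.
by rewrite innerNr -adjointP// innerC mulrN subrr.
Qed.

Lemma pd_skew_monotone P Q : 0 <= inner (P - Q) (pd_skew P - pd_skew Q).
Proof. by rewrite pd_skewB pd_skew_inner. Qed.

Lemma pd_skew_lipschitz (beta : R) P Q :
  0 <= beta -> (forall i, opnorm (L i) <= beta) ->
  `|pd_skew P - pd_skew Q| <= beta * `|P - Q|.
Proof.
move=> beta0 Lbeta; rewrite pd_skewB; move: (P - Q) => X.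
have sq_le (u v : R) i : 0 <= u -> 0 <= v -> u <= opnorm (L i) * v ->
    w i * u ^+ 2 <= w i * (beta * v) ^+ 2.
  move=> u0 v0 uv; rewrite ler_pM2l// ler_pXn2r ?nnegrE ?mulr_ge0//.
  by apply: le_trans uv _; rewrite ler_wpM2r.
rewrite -(ler_pXn2r (n := 2)) ?nnegrE ?mulr_ge0// exprMn !inner_norm !pd_innerE.
rewrite mulrDr !mulr_sumr addrC; apply: lerD; apply: ler_sum => i _.
  rewrite mulrCA pd_dual_skew -!inner_norm normrN -exprMn.
  by apply: sq_le => //; exact: opnorm_le.
rewrite mulrCA pd_primal_skew -!inner_norm -exprMn.
by apply: sq_le => //; exact: adjoint_le.
Qed.

(** The primal part contributes nothing: a constant family is paired with a
    difference of two values, whose weighted sum is [0]. *)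
Lemma pd_op_monotone :
  (forall i, maximally_monotone (B i)) -> Defs.monotone pd_op.
Proof.
move=> maxB [P U] [Q V] /= [[x Px] sU BU] [[y Qy] sV BV].
rewrite pd_innerE; apply: addr_ge0; last first.
  apply: sumr_ge0 => i _; rewrite mulr_ge0 ?(ltW (w_gt0 i))// innerC.
  have := (maxB i).1 _ _ (BU i : gra (B i) (_, _)) (BV i : gra (B i) (_, _)).
  by rewrite /= !pdE opprB addrA subrK.
rewrite (_ : \sum_i _ = inner (x - y) (\sum_i w i *: pd_primal (U - V) i)).
  under eq_bigr do rewrite !pdE scalerBr.
  by rewrite sumrB sU sV subrr inner0r.
rewrite inner_sumr; apply: eq_bigr => i _.
by rewrite !pdE Px Qy innerZr.
Qed.

Local Notation pd_sum := (op_add pd_op pd_skew).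

Lemma pd_sumP P U : pd_sum P U <-> pd_op P (U - pd_skew P).
Proof.
split=> [[V PV <-]|PU]; first by rewrite addrK.
by exists (U - pd_skew P); rewrite // subrK.
Qed.

Lemma pd_zeroP P : pd_sum P 0 <->
  exists x, [/\ forall i, pd_primal P i = x,
    \sum_i w i *: adjoint (L i) (pd_dual P i) = z &
    forall i, B i (L i x - r i) (pd_dual P i)].
Proof.
rewrite pd_sumP sub0r; split=> [[[x Px] sP BP]|[x [Px sP BP]]].
  exists x; split => // [|i].
    apply: oppr_inj; rewrite -sP -sumrN; apply: eq_bigr => i _.
    by rewrite pdE pd_primal_skew scalerN.
  by have := BP i; rewrite pdE pd_dual_skew opprK Px.
split; first by exists x.
  rewrite -sP -sumrN; apply: eq_bigr => i _.
  by rewrite pdE pd_primal_skew scalerN.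
by move=> i; rewrite pdE pd_dual_skew opprK Px.
Qed.

(** Let [(P, U)] be monotonically related to the graph, and test it against the
    point [(y, d)] with the normal vector [n].  Scaling [n] forces the primal
    part of [P] to be constant.  Then letting [y] run through a line forces the
    weighted sum of the primal part of [U - pd_skew P] to be [- z].  What remains
    is the weighted sum of the monotonicity inequalities of the [B i], to which
    [maximally_monotone_family] applies. *)
Lemma pd_sum_maximal : (forall i, maximally_monotone (B i)) ->
  (exists c d : forall i, G i, forall i, B i (c i) (d i)) ->
  maximally_monotone pd_sum.
Proof.
move=> maxB [c0 [d0 Bcd0]]; apply: maximally_monotoneI.
  move=> [P U] [Q V]; rewrite /gra /= => -[U' PU' <-] [V' QV' <-].
  rewrite [U' + _ - _](_ : _ = (U' - V') + (pd_skew P - pd_skew Q)).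
    rewrite innerDr addr_ge0 ?pd_skew_monotone//.
    exact: (pd_op_monotone maxB (PU' : gra pd_op (P, U'))
      (QV' : gra _ (Q, V'))).
  by apply: inner_inj => s; rewrite !innerE; ring.
move=> P U rel; apply/pd_sumP.
have test (y : H) (n : 'I_m -> H) (c d : forall i, G i) :
    \sum_i w i *: n i = 0 -> (forall i, B i (c i) (d i)) ->
  0 <= \sum_i w i * inner (pd_primal P i - y)
          (pd_primal U i - (n i - z) - adjoint (L i) (d i)) +
       \sum_i w i * inner (pd_dual P i - d i)
          (pd_dual U i - (r i + c i) + L i y).
  move=> n0 Bcd.
  pose Q := pd_pair (fun=> y) d.
  pose V := pd_pair (fun i => n i - z) (fun i => r i + c i).
  have QV : pd_sum Q (V + pd_skew Q).
    exists V => //; split; first by exists y.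
      under eq_bigr do rewrite pdE scalerBr.
      by rewrite sumrB n0 -scaler_suml w_sum scale1r sub0r.
    by move=> i; rewrite !pdE addrAC subrr add0r.
  have := rel _ _ QV; rewrite pd_innerE => /le_trans; apply.
  rewrite le_eqVlt; apply/orP; left; apply/eqP; congr (_ + _).
    apply: eq_bigr => i _; rewrite !(pdE, pd_primal_skew).
    by rewrite [- (_ + adjoint _ _)]opprD addrA.
  apply: eq_bigr => i _; rewrite !(pdE, pd_dual_skew).
  by rewrite [- (_ - L _ _)]opprD opprK addrA.
pose X := \sum_i w i *: pd_primal P i.
have dX_sum : \sum_i w i *: (pd_primal P i - X) = 0.
  under eq_bigr do rewrite scalerBr.
  by rewrite sumrB -scaler_suml w_sum scale1r subrr.
clearbody X.
(* test with [y = X] and [n] a multiple of [pd_primal P - X] *)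
have PX i : pd_primal P i = X.
  pose k0 := \sum_i w i * inner (pd_primal P i - X)
      (pd_primal U i + z - adjoint (L i) (d0 i)) +
    \sum_i w i * inner (pd_dual P i - d0 i)
      (pd_dual U i - (r i + c0 i) + L i X).
  have /affine_ge0_slope slope0 : forall t, 0 <=
      k0 + t * - \sum_i w i * `|pd_primal P i - X| ^+ 2.
    move=> t; have := test X (fun i => t *: (pd_primal P i - X)) c0 d0 _ Bcd0.
    have h0 : \sum_i w i *: (t *: (pd_primal P i - X)) = 0.
      under eq_bigr do rewrite scalerA mulrC -scalerA.
      by rewrite -scaler_sumr dX_sum scaler0.
    move=> /(_ h0) /le_trans; apply.
    rewrite le_eqVlt; apply/orP; left; apply/eqP.
    rewrite /k0 addrAC; congr (_ + _).
    rewrite -sumrN mulr_sumr -big_split; apply: eq_bigr => j _ /=.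
    rewrite inner_norm; move: (pd_primal P j - X) => e.
    by rewrite !innerE; ring.
  have sum0 : \sum_i w i * `|pd_primal P i - X| ^+ 2 = 0.
    by apply: oppr_inj; rewrite slope0 oppr0.
  move/psumr_eq0P in sum0.
  have /eqP : w i * `|pd_primal P i - X| ^+ 2 = 0.
    by apply: sum0 => // j _; rewrite mulr_ge0 ?sqr_ge0// ltW.
  by rewrite mulf_eq0 gt_eqF//= sqrf_eq0 normr_eq0 subr_eq0 => /eqP.
have n0 : \sum_(i < m) w i *: (0 : H) = 0.
  by rewrite big1// => i _; rewrite scaler0.
pose Y := z + \sum_i w i *: (pd_primal U i - adjoint (L i) (pd_dual P i)).
pose k c d := \sum_i w i * inner (pd_dual P i - d i)
  (pd_dual U i + L i X - r i - c i).
(* test with [n = 0] and [y] on the line through [X] directed by [h] *)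
have test' h (t : R) (c d : forall i, G i) : (forall i, B i (c i) (d i)) ->
    0 <= k c d + t * inner h Y.
  move=> Bcd.
  have := test (X - t *: h) (fun=> 0) c d n0 Bcd => /le_trans; apply.
  rewrite le_eqVlt; apply/orP; left; apply/eqP.
  have -> : Y = \sum_i w i *: (z + pd_primal U i - adjoint (L i) (pd_dual P i)).
    under [RHS]eq_bigr do rewrite -addrA scalerDr.
    by rewrite big_split /= -scaler_suml w_sum scale1r.
  rewrite inner_sumr mulr_sumr /k -!big_split; apply: eq_bigr => i _ /=.
  have LE : L i (X - t *: h) = L i X - t *: L i h by rewrite linearB linearZ.
  rewrite PX LE.
  have adjE s : inner h (adjoint (L i) s) = inner (L i h) s by rewrite adjointP.
  rewrite !innerE !adjE !(innerC _ (L i h)) !(innerC _ (L i X)).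
  by ring.
have Y0 : Y = 0.
  apply: inner_self_eq0; apply: affine_ge0_slope => t; exact: test' Bcd0.
split; first by exists X.
  have -> : - z = Y - z by rewrite Y0 sub0r.
  rewrite /Y addrAC subrr add0r.
  by apply: eq_bigr => i _; rewrite pd_primalD pd_primalN.
apply: (maximally_monotone_family w_gt0 maxB) => c d Bcd.
have := test' 0 0 c d Bcd; rewrite mul0r addr0 => /le_trans; apply.
rewrite le_eqVlt; apply/orP; left; apply/eqP; apply: eq_bigr => i _.
by rewrite pd_dualD pd_dualN pd_dual_skew opprK PX innerC.
Qed.

End PrimalDual.
Theorem theorem3p8 (R : realType) (H : hilbertType R) (m : nat)
    (m_ge1 : (1 <= m)%N) (z : H)
    (w : 'I_m -> R) (w_gt0 : forall i, 0 < w i) (w_le1 : forall i, w i <= 1)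
    (w_sum : \sum_(i < m) w i = 1)
    (G : 'I_m -> hilbertType R)
    (r : forall i, G i)
    (B : forall i, G i -> set (G i))
    (B_maxmon : forall i, maximally_monotone (B i))
    (L : forall i, {linear H -> G i})
    (L_bounded : forall i, bounded_near (L i) (nbhs (0 : H)))
    (L_neq0 : forall i, exists x, L i x != 0)
    (z_ran : ran (composite_op w L r B) z)
    (a1 c1 : 'I_m -> nat -> H)
    (a2 b c2 : forall i, nat -> G i)
    (a1_sum : forall i, absolutely_summable (a1 i))
    (c1_sum : forall i, absolutely_summable (c1 i))
    (a2_sum : forall i, absolutely_summable (a2 i))
    (b_sum : forall i, absolutely_summable (b i))
    (c2_sum : forall i, absolutely_summable (c2 i))
    (beta : R) (beta_def : beta = \big[Num.max/0]_(i < m) opnorm (L i))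
    (eps : R) (eps_gt0 : 0 < eps) (eps_lt : eps < 1 / (beta + 1))
    (gam : nat -> R)
    (gam_ge : forall n, eps <= gam n)
    (gam_le : forall n, gam n <= (1 - eps) / beta)
    (x : 'I_m -> nat -> H) (v : forall i, nat -> G i)
    (xs p1 : nat -> H)
    (y1 q1 : 'I_m -> nat -> H)
    (y2 p2 q2 : forall i, nat -> G i)
    (xs_def : forall n, xs n = \sum_(i < m) w i *: x i n)
    (y1_def : forall i n,
       y1 i n = x i n - gam n *: (adjoint (L i) (v i n) + a1 i n))
    (y2_def : forall i n,
       y2 i n = v i n + gam n *: (L i (x i n) + a2 i n))
    (p1_def : forall n, p1 n = \sum_(i < m) w i *: y1 i n + gam n *: z)
    (p2_def : forall i n,
       p2 i n = J (op_scale (gam n) (opinv (B i))) (y2 i n - gam n *: r i)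
                + b i n)
    (q1_def : forall i n,
       q1 i n = p1 n - gam n *: (adjoint (L i) (p2 i n) + c1 i n))
    (q2_def : forall i n,
       q2 i n = p2 i n + gam n *: (L i (p1 n) + c2 i n))
    (x_rec : forall i n, x i n.+1 = x i n - y1 i n + q1 i n)
    (v_rec : forall i n, v i n.+1 = v i n - y2 i n + q2 i n) :
  exists (xbar : H) (vbar : forall i, G i),
    [/\ primal_solution w L r B z xbar,
        dual_solution w L r B z vbar,
        forall i, B i (L i xbar - r i) (vbar i),
        weak_cvg xs xbar /\ (forall i, weak_cvg (v i) (vbar i)) &
        (forall i, strongly_monotone_at (opinv (B i)) (vbar i)) ->
        forall i, v i n @[n --> \oo] --> vbar i].
Proof.
have beta_ge i : opnorm (L i) <= beta.
  by rewrite beta_def; apply: le_bigmax.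
have opnorm_gt0 i : 0 < opnorm (L i).
  have [s Ls] := L_neq0 i; have := opnorm_le (L_bounded i) s.
  rewrite lt_neqAle opnorm_ge0// andbT; apply: contraTneq => <-.
  by rewrite mul0r -ltNge normr_gt0.
have beta_gt0 : 0 < beta.
  exact: lt_le_trans (opnorm_gt0 (Ordinal m_ge1)) (beta_ge _).
have eps_le1 : eps <= 1.
  apply/ltW/(lt_le_trans eps_lt); rewrite ler_pdivrMr ?mul1r ?addr_gt0//.
  by rewrite lerDr ltW.
have gam_gt0 n : 0 < gam n by exact: lt_le_trans (gam_ge n).
have gam_beta n : gam n * beta <= 1 - eps by rewrite -ler_pdivlMr.
pose K := pd_space (H := H) w_gt0 G.
pose pr := @pd_pair R H m w w_gt0 G.
pose A := @pd_op R H m z w w_gt0 G r B.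
pose S := @pd_skew R H m w w_gt0 G L.
have [x0 [v0 [Bv0 sv0]]] : exists x0 (v0 : forall i, G i),
    (forall i, B i (L i x0 - r i) (v0 i)) /\
    \sum_i w i *: adjoint (L i) (v0 i) = z.
  have [x0 [f fP fz]] := z_ran.
  have ex i : {s | B i (L i x0 - r i) s /\ w i *: adjoint (L i) s = f i}.
    by apply: cid; have [s Bs sE] := fP i; exists s.
  exists x0, (fun i => sval (ex i)).
  split=> [i|]; first by have [] := svalP (ex i).
  by rewrite -fz; apply: eq_bigr => i _; have [] := svalP (ex i).
have zero : exists P, op_add A S P 0.
  exists (pr (fun=> x0) v0); apply/pd_zeroP => //.
  by exists x0.
have maxAS : maximally_monotone (op_add A S).
  apply: pd_sum_maximal => //.
  by exists (fun i => L i x0 - r i), v0.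
(* the dual coordinates of [S] carry a minus sign, hence so do their errors *)
pose pa n := pr (fun i => a1 i n) (fun i => - a2 i n).
pose pc n := pr (fun i => c1 i n) (fun i => - c2 i n).
pose pb n := pr (fun=> 0) (fun i => b i n).
pose X n := pr (fun i => x i n) (fun i => v i n).
pose Y n := pr (fun i => y1 i n) (fun i => y2 i n).
pose P n := pr (fun=> p1 n) (fun i => p2 i n).
pose Q n := pr (fun i => q1 i n) (fun i => q2 i n).
have sumN (E : hilbertType R) (s : nat -> E) : absolutely_summable s ->
    absolutely_summable (fun n => - s n).
  move=> s_sum; rewrite /absolutely_summable.
  rewrite (_ : [normed series _] = [normed series s])//.
  by apply/funext => n; apply: eq_bigr => k _; rewrite /= normrN.
have sum0 : absolutely_summable (fun=> 0 : H).
  rewrite /absolutely_summable (_ : [normed series _] = fun=> 0).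
    exact: is_cvg_cst.
  by apply/funext => n; apply: big1 => k _; exact: normr0.
have pa_sum : absolutely_summable pa.
  apply: absolutely_summable_coord => -[i|i]; first exact: a1_sum.
  exact/sumN/a2_sum.
have pb_sum : absolutely_summable pb.
  by apply: absolutely_summable_coord => -[i|i]; [exact: sum0|exact: b_sum].
have pc_sum : absolutely_summable pc.
  apply: absolutely_summable_coord => -[i|i]; first exact: c1_sum.
  exact/sumN/c2_sum.
have YE n : Y n = X n - gam n *: (S (X n) + pa n).
  apply: pd_ext => i; first exact: y1_def.
  rewrite [LHS]y2_def pd_dualD pd_dualN pd_dualZ pd_dualD pd_dual_skew.
  by rewrite -scalerN opprD !opprK.
have QE n : Q n = P n - gam n *: (S (P n) + pc n).
  apply: pd_ext => i; first exact: q1_def.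
  rewrite [LHS]q2_def pd_dualD pd_dualN pd_dualZ pd_dualD pd_dual_skew.
  by rewrite -scalerN opprD !opprK.
have XE n : X n.+1 = X n - Y n + Q n.
  by apply: pd_ext => i; [exact: x_rec | exact: v_rec].
have Ppb n i : pd_primal (P n - pb n) i = p1 n by exact: subr0.
have PE n : resolvent (op_scale (gam n) A) (Y n) (P n - pb n).
  pose U := (gam n)^-1 *: (Y n - (P n - pb n)).
  have gU : gam n *: U = Y n - (P n - pb n).
    by rewrite scalerA divff ?gt_eqF// scale1r.
  exists (gam n *: U); last by rewrite gU addrC subrK.
  exists U => //; split.
  - by exists (p1 n).
  - under eq_bigr do rewrite pd_primalZ pd_primalD pd_primalN Ppb scalerA
      mulrC -scalerA.
    rewrite -scaler_sumr; under eq_bigr do rewrite scalerBr.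
    rewrite sumrB -scaler_suml w_sum scale1r p1_def opprD addrA subrr sub0r.
    by rewrite scalerN scalerA mulVf ?gt_eqF// scale1r.
  - move=> i; set j := pd_dual (P n - pb n) i.
    pose s := y2 i n - gam n *: r i.
    have jE : j = J (op_scale (gam n) (opinv (B i))) s.
      by rewrite /j pd_dualD pd_dualN [pd_dual (P n) i]p2_def addrK.
    have maxi := maximally_monotone_scale (gam_gt0 n)
      (maximally_monotone_opinv (B_maxmon i)).
    have [c Bc gc] := J_resolvent s maxi; rewrite -jE in Bc gc.
    rewrite (_ : pd_dual U i - r i = c)//.
    have -> : pd_dual U i = (gam n)^-1 *: (y2 i n - j) by [].
    have -> : y2 i n - j = gam n *: (c + r i).
      by rewrite scalerDr gc /s addrAC subrK.
    by rewrite scalerA mulVf ?gt_eqF// scale1r addrK.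
have [Xbar [U [Xbar0 X_cvg XP_cvg AU gap_cvg]]] :=
  forward_backward_forward_cvg (pd_op_monotone B_maxmon) maxAS
    (fun s t => pd_skew_monotone L_bounded s t)
    (fun s t => pd_skew_lipschitz L_bounded s t (ltW beta_gt0) beta_ge)
    beta_gt0 eps_gt0 eps_le1 gam_ge gam_beta pa_sum pb_sum pc_sum
    YE PE QE XE zero.
have [xbar [Xbar_x Xbar_z BXbar]] := (pd_zeroP _ _ _ _ _).1 Xbar0.
pose vbar i := pd_dual Xbar i.
exists xbar, vbar; split.
- exists (fun i => w i *: adjoint (L i) (vbar i)) => // i.
  by exists (vbar i) => //; exact: BXbar.
- by split => //; exists xbar.
- exact: BXbar.
- split; last first.
    move=> i; exact: (@weak_cvg_coord R _ (pd_weight w_gt0) (pd_factor G)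
      X Xbar (inr i) X_cvg).
  move=> y; pose yy := pr (fun=> y) (fun=> 0).
  have yyE (V : K) : inner V yy = inner (\sum_i w i *: pd_primal V i) y.
    rewrite pd_innerE inner_suml [X in _ + X]big1 ?addr0 => [|i _].
      by apply: eq_bigr => i _; rewrite innerZl.
    by rewrite inner0r mulr0.
  have -> : inner xbar y = inner Xbar yy.
    rewrite yyE; under eq_bigr do rewrite Xbar_x.
    by rewrite -scaler_suml w_sum scale1r.
  rewrite (_ : (fun n => _) = (fun n => inner (X n) yy)); first exact: X_cvg.
  by apply/funext => n; rewrite yyE xs_def.
- move=> strong i.
  have [_ [rho rho0 rhoP]] := strong i.
  (* The primal coordinates of [p - xbar] are constant and pair to zero, so the
     vanishing inner product is a sum of nonnegative dual contributions, the
     one of index [i] being bounded below by strong monotonicity. *)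
  have dual_gap j n : 0 <= inner (pd_dual (P n - pb n - Xbar) j)
      (pd_dual (U n + S Xbar) j).
    have [_ _ BU] := AU n.
    have := (B_maxmon j).1 _ _ (BU j : gra (B j) (_, _))
      (BXbar j : gra (B j) (_, _)).
    rewrite /= innerC opprB addrA subrK.
    by rewrite !pd_dualD pd_dualN pd_dual_skew Xbar_x.
  have gapE n : inner (P n - pb n - Xbar) (U n + S Xbar) =
      \sum_j w j * inner (pd_dual (P n - pb n - Xbar) j)
        (pd_dual (U n + S Xbar) j).
    have [[s sE] sU _] := AU n.
    rewrite pd_innerE [X in X + _](_ : _ = inner (s - xbar)
      (\sum_j w j *: pd_primal (U n + S Xbar) j)); last first.
      rewrite inner_sumr; apply: eq_bigr => j _.
      by rewrite innerZr pd_primalD pd_primalN sE Xbar_x.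
    under eq_bigr do rewrite pd_primalD pd_primal_skew scalerDr.
    by rewrite big_split /= sU Xbar_z addNr inner0r add0r.
  have le_gap n : rho * `|vbar i - pd_dual (P n - pb n) i| ^+ 2 <=
      (w i)^-1 * inner (P n - pb n - Xbar) (U n + S Xbar).
    have [_ _ BU] := AU n.
    rewrite ler_pdivlMl// gapE (bigD1 i)//=.
    apply: ler_wpDr.
      by apply: sumr_ge0 => j _; rewrite mulr_ge0 ?(ltW (w_gt0 j)).
    rewrite ler_pM2l//.
    have := rhoP _ (BXbar i) (_, _) (BU i : gra (opinv (B i)) (_, _)).
    move=> /le_trans; apply; rewrite le_eqVlt; apply/orP; left; apply/eqP.
    rewrite [pd_dual (_ - Xbar) i]pd_dualD pd_dualN /= -/(vbar i).
    move: (pd_dual (P n - pb n) i) => j; rewrite pd_dualD pd_dual_skew Xbar_x.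
    by rewrite !innerE; ring.
  have sqr0 : `|vbar i - pd_dual (P n - pb n) i| ^+ 2 @[n --> \oo] --> 0.
    have ub : rho^-1 * ((w i)^-1 * inner (P n - pb n - Xbar) (U n + S Xbar))
        @[n --> \oo] --> 0.
      rewrite -[X in _ --> X](mulr0 rho^-1); apply: cvgMl_tmp.
      by rewrite -[X in _ --> X](mulr0 (w i)^-1); apply: cvgMl_tmp.
    apply: (squeeze_cvgr _ (cvg_cst 0) ub); apply: nearW => n.
    by rewrite sqr_ge0/= ler_pdivlMl.
  have p_cvg : pd_dual (P n - pb n) i @[n --> \oo] --> vbar i.
    apply/cvgrPdist_lt => e e0.
    have near0 := (cvgrPdist_lt _ _).1 sqr0 (e ^+ 2) (exprn_gt0 2 e0).
    near=> n; have : `|0 - `|vbar i - pd_dual (P n - pb n) i| ^+ 2| < e ^+ 2.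
      by near: n; exact: near0.
    rewrite sub0r normrN ger0_norm ?sqr_ge0//.
    by rewrite ltr_pXn2r ?nnegrE ?(ltW e0).
  have vp_cvg : v i n - pd_dual (P n - pb n) i @[n --> \oo] --> (0 : G i).
    exact: (@cvg0_coord R _ (pd_weight w_gt0) (pd_factor G) _ _ _ (inr i) _
      XP_cvg).
  rewrite -[vbar i]add0r.
  rewrite (_ : v i = (fun n => v i n - pd_dual (P n - pb n) i) \+
    (fun n => pd_dual (P n - pb n) i)); first exact: cvgD.
  by apply/funext => n /=; rewrite subrK.
Unshelve. all: by end_near. Qed.
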